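(* For every regular unstable RB there exist constants $c>0$ and $N_0$ such that for every $N\ge N_0$ (with $\alpha N$ integer), every policy $\pi$ for the $N$-armed problem whose long-run average reward is well defined, and every initial state vector $\mathbf S_0$, $$R^{\mathrm{rel}}-R(\pi,\mathbf S_0)\ge\frac{c}{\sqrt N}.$$
   Context: Single-armed MDP $(\mathbb S,\{0,1\},P,r)$, finite $\mathbb S$, budget $\alpha\in(0,1)$. $N$-armed problem: $N$ arms transition independently by $P$ given states and actions; at each $t$ a policy chooses $A_t(i)\in\{0,1\}$ with $\sum_iA_t(i)=\alpha N$. $S_t(i)$ arm states, $X_t([N])=(X_t([N],s))_s$ with $X_t([N],s)=\frac1N\#\{i:S_t(i)=s\}$. $R(\pi,\mathbf S_0)=\lim_{T\to\infty}\frac1T\sum_{t<T}\frac1N\sum_i\mathbb E[r(S_t(i),A_t(i))]$. LP relaxation: maximize $\sum r(s,a)y(s,a)$ over $y\ge0$ s.t. $\sum_sy(s,1)=\alpha$, $\sum_{s',a}y(s',a)P(s',a,s)=\sum_ay(s,a)$ for all $s$, $\sum y=1$; $R^{\mathrm{rel}}$ its optimal value, $y^*$ an optimal solution. $\bar\pi^*(a|s)=y^*(s,a)/(y^*(s,0)+y^*(s,1))$ if denominator $>0$, else $1/2$; $P_{\bar\pi^*}(s,s')=\sum_a\bar\pi^*(a|s)P(s,a,s')$; $\mu^*(s)=y^*(s,0)+y^*(s,1)$. Assumption 1: $1$ is a simple eigenvalue of $P_{\bar\pi^*}$, all other eigenvalues have modulus $<1$. Assumption 2: unique $\tilde s$ with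 $y^*(\tilde s,0),y^*(\tilde s,1)>0$. $\Phi=P_{\bar\pi^*}-\mathbf 1^\top\mu^*-(c-\alpha\mathbf 1)^\top(P_1(\tilde s)-P_0(\tilde s))$, $c=(\bar\pi^*(1|s))_s$, $P_a(\tilde s)=(P(\tilde s,a,s))_s$, $\mathbf 1$ all-ones row vector. $S^+=\{s:y^*(s,1)>0,y^*(s,0)=0\}$, $S^-=\{s:y^*(s,1)=0,y^*(s,0)>0\}$, $S^\emptyset=\{s:y^*(s,1)=y^*(s,0)=0\}$. Randomized rounding of $c\ge0$: $\lceil c\rceil$ w.p. $c-\lfloor c\rfloor$, else $\lfloor c\rfloor$. Optimal Local Control (OLC) applied to all $N$ arms, with $z(s)$ arms in state $s$, is defined when $\sum_{s\neq\tilde s}\bar\pi^*(1|s)z(s)\le\alpha N-|S^\emptyset|-1$ and $\sum_{s\neq\tilde s}\bar\pi^*(0|s)z(s)\le(1-\alpha)N-|S^\emptyset|-1$: let $B$ be a randomized rounding of $\alpha N$; activate all arms in $S^+$, none in $S^-$, a randomized rounding of $z(s)/2$ arms in each $s\in S^\emptyset$, and arms in $\tilde s$ so that exactly $B$ are active. Regular unstable RB: an instance satisfying Assumptions 1 and 2 and: (a) the LP relaxation has a unique optimal solution $y^*$ and $y^*(s,1)+y^*(s,0)>0$ for all $s$; (b) $\Phi$ has at least one eigenvalue of modulus $>1$ and no eigenvalue of modulus exactly $1$; (c) there are constants $\eta',K_{\mathrm{noise}}>0$ (with $\eta'$ small enough that OLC is defined whenever $\|X_t([N])-\mu^*\|_1\le\eta'$)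 such that for all sufficiently large $N$, every $t$, and every $\xi\in\mathbb R^{\mathbb S}$ with $\|\xi\|_2=1$ and $\mu^*\xi^\top=0$: if $\|X_t([N])-\mu^*\|_1\le\eta'$ and $\mathbf A_t$ is chosen by OLC applied to all $N$ arms, then $\mathbb E\big[|(X_{t+1}([N])-\mu^*-(X_t([N])-\mu^* )\Phi)\xi^\top|\,\big|\,X_t,\mathbf A_t\big]\ge K_{\mathrm{noise}}/\sqrt N$. *)

(* Defs.v *)
From HB Require Import structures.
From mathcomp Require Import all_boot all_order all_algebra.
From mathcomp Require Import all_classical all_reals all_analysis.
From mathcomp Require Import complex.

Set Implicit Arguments.
Unset Strict Implicit.
Unset Printing Implicit Defensive.

Import Order.TTheory GRing.Theory Num.Theory.
Local Open Scope ring_scope.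

(* Single-armed MDP: state space 'I_n, actions bool (true = 1 = active),
   transition kernel P s a s', reward r s a. *)
Section RB.
Variables (R : realType) (n : nat).
Variables (P : 'I_n -> bool -> 'I_n -> R) (r : 'I_n -> bool -> R) (alpha : R).

Definition stochastic_kernel : Prop :=
  (forall s a s', 0 <= P s a s') /\ (forall s a, \sum_s' P s a s' = 1).

Definition LPobj (y : 'I_n -> bool -> R) : R := \sum_s \sum_a r s a * y s a.

Definition LPfeasible (y : 'I_n -> bool -> R) : Prop :=
  [/\ forall s a, 0 <= y s a,
      \sum_s y s true = alpha,
      forall s, \sum_s' \sum_a y s' a * P s' a s = \sum_a y s a
    & \sum_s \sum_a y s a = 1].

Definition LPoptimal (y : 'I_n -> bool -> R) : Prop :=
  LPfeasible y /\ forall y', LPfeasible y' -> LPobj y' <= LPobj y.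

Variable ystar : 'I_n -> bool -> R.

Definition pibar (a : bool) (s : 'I_n) : R :=
  if 0 < ystar s false + ystar s true
  then ystar s a / (ystar s false + ystar s true) else 2^-1.

Definition Ppibar : 'M[R]_n := \matrix_(s, s') \sum_a pibar a s * P s a s'.

Definition mustar : 'rV[R]_n := \row_s (ystar s false + ystar s true).

Definition cvec : 'rV[R]_n := \row_s pibar true s.

Definition ones : 'rV[R]_n := const_mx 1.

Definition Pa_row (st : 'I_n) (a : bool) : 'rV[R]_n := \row_s' P st a s'.

Definition Phi (st : 'I_n) : 'M[R]_n :=
  Ppibar - (ones^T *m mustar)
  - ((cvec - alpha *: ones)^T *m (Pa_row st true - Pa_row st false)).

Definition cmx (M : 'M[R]_n) : 'M[R[i]]_n := map_mx (fun x => (x%:C)%C) M.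
Definition eigenvalue_of (M : 'M[R]_n) (z : R[i]) : bool :=
  root (char_poly (cmx M)) z.
Definition alg_mult (M : 'M[R]_n) (z : R[i]) : nat := mup z (char_poly (cmx M)).

Definition Splus : pred 'I_n := fun s => (0 < ystar s true) && (ystar s false == 0).
Definition Sminus : pred 'I_n := fun s => (ystar s true == 0) && (0 < ystar s false).
Definition Sempty : pred 'I_n := fun s => (ystar s true == 0) && (ystar s false == 0).

Variable N : nat.
Definition Sn := {ffun 'I_N -> 'I_n}.
Definition An := {ffun 'I_N -> bool}.

Definition nactive (a : An) : nat := #|[set i | a i]|.

Definition PN (s : Sn) (a : An) (s' : Sn) : R := \prod_i P (s i) (a i) (s' i).

Definition zcount (s : Sn) (j : 'I_n) : nat := #|[set i | s i == j]|.
Definition zact (s : Sn) (a : An) (j : 'I_n) : nat := #|[set i | (s i == j) && a i]|.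

Definition Xemp (s : Sn) : 'rV[R]_n := \row_j ((zcount s j)%:R / N%:R).

Definition norm1 (v : 'rV[R]_n) : R := \sum_j `|v 0 j|.

(* Histories are stored most-recent-first: a history of length t is
   [:: (S_{t-1},A_{t-1}); ...; (S_0,A_0)].  A (history-dependent, randomized)
   policy maps a history and the current state to a distribution over action
   vectors. *)
Definition policy := seq (Sn * An) -> Sn -> An -> R.

Definition valid_policy (nb : nat) (pi : policy) : Prop :=
  [/\ forall h s a, 0 <= pi h s a,
      forall h s, \sum_a pi h s a = 1
    & forall h s a, nactive a != nb -> pi h s a = 0].

Fixpoint hprob (pi : policy) (S0 : Sn) (h : seq (Sn * An)) (s : Sn) : R :=
  match h with
  | [::] => (s == S0)%:R
  | (s', a') :: h' => hprob pi S0 h' s' * pi h' s' a' * PN s' a' s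
  end.

Definition exp_reward (pi : policy) (S0 : Sn) (t : nat) : R :=
  \sum_(h : t.-tuple (Sn * An)) \sum_s \sum_a
     hprob pi S0 h s * pi h s a * (N%:R^-1 * \sum_i r (s i) (a i)).

Definition avg_reward (pi : policy) (S0 : Sn) (T : nat) : R :=
  T%:R^-1 * \sum_(t < T) exp_reward pi S0 t.

(* OLC applied to all N arms (budget B = nb since alpha N = nb is an integer):
   definedness conditions and support of the action vectors it can produce. *)
Definition OLC_defined (st : 'I_n) (nb : nat) (s : Sn) : Prop :=
  \sum_(j | j != st) pibar true j * (zcount s j)%:R
     <= nb%:R - (#|Sempty|)%:R - 1 /\
  \sum_(j | j != st) pibar false j * (zcount s j)%:R
     <= (N%:R - nb%:R) - (#|Sempty|)%:R - 1.

Definition OLC_support (st : 'I_n) (nb : nat) (s : Sn) (a : An) : Prop :=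
  [/\ nactive a = nb,
      forall i, Splus (s i) -> a i = true,
      forall i, Sminus (s i) -> a i = false
    & forall j, Sempty j -> j != st ->
        zact s a j = (zcount s j)./2 \/ zact s a j = uphalf (zcount s j)].

End RB.

Definition regular_unstable (R : realType) (n : nat)
  (P : 'I_n -> bool -> 'I_n -> R) (r : 'I_n -> bool -> R) (alpha : R)
  (ystar : 'I_n -> bool -> R) (st : 'I_n) : Prop :=
  [/\
   alg_mult (Ppibar P ystar) 1 = 1%N /\
     (forall z, eigenvalue_of (Ppibar P ystar) z -> z != 1 -> `|z| < 1),
   (forall s, (0 < ystar s false) && (0 < ystar s true) <-> s = st),
   (LPoptimal P r alpha ystar /\
      (forall y, LPoptimal P r alpha y -> forall s a, y s a = ystar s a)) /\
     (forall s, 0 < ystar s true + ystar s false),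
   (exists z, eigenvalue_of (Phi P alpha ystar st) z /\ 1 < `|z|) /\
     (forall z, eigenvalue_of (Phi P alpha ystar st) z -> `|z| != 1)
  &
   exists eta K : R, 0 < eta /\ 0 < K /\
     exists N1 : nat, forall N : nat, (N1 <= N)%N ->
     forall nb : nat, nb%:R = alpha * N%:R ->
     forall s : Sn n N, norm1 (Xemp R s - mustar ystar) <= eta ->
       OLC_defined ystar st nb s /\
       forall a : An N, OLC_support ystar st nb s a ->
       forall xi : 'rV[R]_n, \sum_j xi 0 j ^+ 2 = 1 ->
         (mustar ystar *m xi^T) 0 0 = 0 ->
         K / Num.sqrt N%:R <=
         \sum_(s' : Sn n N) PN P s a s' *
           `| ((Xemp R s' - mustar ystar
                 - (Xemp R s - mustar ystar) *m Phi P alpha ystar st) *m xi^T) 0 0|].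

(* Main.v *)
Require Import Defs.
From mathcomp Require Import all_boot all_order all_algebra.
From mathcomp Require Import all_classical all_reals all_analysis.
From mathcomp Require Import complex spectral ring lra zify.
From mathcomp Require Import fintype finset.
Import Order.TTheory GRing.Theory Num.Theory.
Import numFieldNormedType.Exports.
Local Open Scope ring_scope.
Set Implicit Arguments.
Unset Strict Implicit.
Unset Printing Implicit Defensive.

(* LP duality with strict complementarity turns the gap to the relaxed value into
   the long-run fraction of "bad" arms, those taking an action that the optimal LP
   solution never takes in their state.  Without bad arms the action is an OLC
   action and the centred state distribution x follows x -> x Phi plus noise of
   order 1 / sqrt N; in general the drift is perturbed by a multiple of the
   fraction of bad arms.  Near the fixed point the noise excites the unstable
   direction of Phi, so the modulus of the unstable coordinate grows on average by
   at least c / sqrt N.  Far from it, a function G that is Lipschitz and satisfies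
   G (x Phi) >= G x + d |x| grows by a constant.  A combination V of the two thus
   has drift at least c / sqrt N minus a multiple of the fraction of bad arms; as V
   is bounded, this fraction is of order at least 1 / sqrt N on average. *)

(** * Lyapunov functions of hyperbolic linear maps *)

(** The bound [1 / (1 + sum of 1 / f)] takes no minimum, so an empty index type needs no separate
    case. *)
Lemma finite_pos_lower_bound (R : realFieldType) (T : finType) (f : T -> R) :
  (forall i, 0 < f i) -> exists2 d, 0 < d & forall i, d <= f i.
Proof.
move=> f_gt0; have S_ge0 (Q : pred T) : 0 <= \sum_(i | Q i) (f i)^-1.
  by apply: sumr_ge0 => i _; rewrite invr_ge0 ltW.
exists (1 + \sum_i (f i)^-1)^-1; first by rewrite invr_gt0 ltr_pwDl.
move=> i; rewrite -[leRHS]invrK lef_pV2 ?posrE ?invr_gt0 ?ltr_pwDl//.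
by rewrite (bigD1 i)//= addrCA lerDl addr_ge0.
Qed.

Lemma ler_sum_term (R : numDomainType) (T : finType) (f : T -> R) (i : T) :
  (forall j, 0 <= f j) -> f i <= \sum_j f j.
Proof. by move=> f_ge0; rewrite (bigD1 i)//= lerDl sumr_ge0. Qed.

Definition seminorm (R : realType) (n : nat) (p : 'rV[R]_n -> R) : Prop :=
  (forall x y, p (x + y) <= p x + p y) /\ (forall a x, p (a *: x) = `|a| * p x).

Section Seminorm.
Variables (R : realType) (n : nat) (p : 'rV[R]_n -> R).
Hypothesis sp : seminorm p.

Lemma seminorm0 : p 0 = 0.
Proof. by have := sp.2 0 0; rewrite scale0r normr0 mul0r. Qed.

Lemma seminormN x : p (- x) = p x.
Proof. by rewrite -scaleN1r sp.2 normrN normr1 mul1r. Qed.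

Lemma seminorm_ge0 x : 0 <= p x.
Proof.
have := sp.1 x (- x); rewrite subrr seminorm0 seminormN -mulr2n.
by rewrite pmulrn_lge0.
Qed.

Lemma seminorm_lb x y : p x - p y <= p (x - y).
Proof. by rewrite lerBlDr -{1}(subrK y x) sp.1. Qed.

Lemma seminorm_dist x y : `|p x - p y| <= p (x - y).
Proof. by rewrite ler_norml seminorm_lb andbT lerNl opprB -(opprB y) seminormN seminorm_lb. Qed.

Lemma seminorm_sum (I : finType) (w : I -> R) (x : I -> 'rV[R]_n) :
  p (\sum_i w i *: x i) <= \sum_i `|w i| * p (x i).
Proof.
elim/big_ind2 : _ => [|u a v b ua vb|i _]; first by rewrite seminorm0.
- by apply: le_trans (sp.1 _ _) _; rewrite lerD.
- by rewrite sp.2.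
Qed.

Lemma seminorm_bound : exists2 C, 0 <= C & forall x, p x <= C * norm1 x.
Proof.
exists (\sum_j p (delta_mx 0 j)); first by apply: sumr_ge0 => j _; exact: seminorm_ge0.
move=> x; rewrite {1}(row_sum_delta x); apply: le_trans (seminorm_sum _ _) _.
rewrite mulr_sumr; apply: ler_sum => j _; rewrite mulrC ler_wpM2r//.
by apply: (@ler_sum_term _ _ (fun j => p (delta_mx 0 j))) => k; exact: seminorm_ge0.
Qed.
End Seminorm.

Lemma seminorm_norm1 (R : realType) n : seminorm (@norm1 R n).
Proof.
split=> [x y|a x]; rewrite /norm1.
  by rewrite -big_split/=; apply: ler_sum => j _; rewrite mxE ler_normD.
by rewrite mulr_sumr; apply: eq_bigr => j _; rewrite mxE normrM.
Qed.

Section ComplexDot.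
Variables (R : realType) (n : nat).
Implicit Types (x : 'rV[R]_n) (xi : 'cV[R[i]]_n).

Lemma normcD (z w : R[i]) : Normc.normc (z + w) <= Normc.normc z + Normc.normc w.
Proof. exact: le_normcD. Qed.

Lemma normc_ge0 (z : R[i]) : 0 <= Normc.normc z.
Proof. by case: z => a b; exact: sqrtr_ge0. Qed.

Lemma normc_real (a : R) : Normc.normc (a%:C)%C = `|a|.
Proof. by rewrite /= expr0n addr0 sqrtr_sqr. Qed.

Lemma normc_sum (I : finType) (z : I -> R[i]) :
  Normc.normc (\sum_i z i) <= \sum_i Normc.normc (z i).
Proof.
elim/big_ind2 : _ => [|u a v b ua vb|//]; first by rewrite Normc.normc0.
by apply: le_trans (normcD _ _) _; rewrite lerD.
Qed.

(** The pairing has no conjugation: if [xi] is a right eigenvector of a real matrix [A], then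
    [x -> x A] multiplies it by the eigenvalue. *)
Definition cdot xi x : R[i] := (map_mx (real_complex R) x *m xi) 0 0.

Lemma seminorm_cdot xi : seminorm (fun x => Normc.normc (cdot xi x)).
Proof.
split=> [x y|a x]; rewrite /cdot.
  by rewrite map_mxD mulmxDl mxE normcD.
by rewrite map_mxZ -scalemxAl mxE Normc.normcM normc_real.
Qed.

Lemma Re_cdot xi x : complex.Re (cdot xi x) = (x *m map_mx (@complex.Re R) xi) 0 0.
Proof.
rewrite /cdot !mxE raddf_sum; apply: eq_bigr => j _; rewrite !mxE.
by case: (xi j 0) => a b /=; rewrite mul0r subr0.
Qed.

Lemma normr_Re_le (z : R[i]) : `|complex.Re z| <= Normc.normc z.
Proof. by case: z => a b /=; rewrite -sqrtr_sqr ler_wsqrtr// lerDl sqr_ge0. Qed.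
End ComplexDot.

(** Schur's theorem for the transpose of [A]. In the coordinates [x Q^T] the map [x -> x A] becomes
    multiplication by [T^T], so coordinate [i] of the image depends only on the coordinates up to
    [i]. *)
Lemma triangular_coordinates (R : realType) n (A : 'M[R]_n) : (0 < n)%N ->
  exists Q T : 'M[R[i]]_n, [/\ Q \in unitmx, is_trig_mx T,
    cmx A *m Q^T = Q^T *m T^T & forall i, eigenvalue_of A (T i i)].
Proof.
move=> n_gt0; have [Q Qun] := Schur (cmx A)^T n_gt0.
have Qu := unitarymx_unit Qun.
rewrite /similar_to; set T := conjmx _ _ => trT.
have TQ : T *m Q = Q *m (cmx A)^T.
  by rewrite /T conjumx// mulmxKV.
exists Q, T; split=> //; first by rewrite -trmx_mul TQ trmx_mul trmxK.
move=> i; rewrite /eigenvalue_of -eigenvalue_root_char.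
have : eigenvalue T (T i i).
  rewrite eigenvalue_root_char (char_poly_trig trT).
  by rewrite (bigD1 i)//= rootM root_XsubC eqxx.
case/eigenvalueP => v vT v0.
have eT : eigenvalue (cmx A)^T (T i i).
  apply/eigenvalueP; exists (v *m Q).
    by rewrite -mulmxA -TQ mulmxA vT scalemxAl.
  apply: contra v0 => /eqP vQ.
  by rewrite -(mulmxK Qu v) vQ mul0mx.
move: eT; rewrite !eigenvalue_root_char /char_poly /char_poly_mx.
by rewrite -det_tr linearB/= map_trmx trmxK tr_scalar_mx.
Qed.

Lemma mulmx_trig_coord (C : comNzRingType) n (z : 'rV[C]_n) (T : 'M[C]_n) i :
  is_trig_mx T ->
  (z *m T^T) 0 i = T i i * z 0 i + \sum_(j < n | (j < i)%N) T i j * z 0 j.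
Proof.
move=> /is_trig_mxP trT; rewrite mxE (bigD1 i)//= mxE mulrC; congr (_ + _).
rewrite big_mkcond [RHS]big_mkcond/=; apply: eq_bigr => j _.
rewrite mxE -val_eqE/=; case: ltngtP => // lt; first by rewrite mulrC.
by rewrite trT// mulr0.
Qed.

(** [p i] is the modulus of the [i]-th triangular coordinate. Its diagonal factor has modulus at
    distance at least [d] from 1; the sign [sg i] tells expansion from contraction and turns both
    into growth. The earlier coordinates enter as a perturbation of size [M]. *)
Lemma triangular_drift (R : realType) n (A : 'M[R]_n) :
  (0 < n)%N -> (forall z, eigenvalue_of A z -> `|z| != 1) ->
  exists (p : 'I_n -> 'rV[R]_n -> R) (sg : 'I_n -> R) (d M K : R),
   [/\ forall i, seminorm (p i), forall i, `|sg i| = 1,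
       [/\ 0 < d, 0 <= M & 0 < K],
       forall x, norm1 x <= K * \sum_i p i x &
       forall i x, d * p i x - M * \sum_(j < n | (j < i)%N) p j x
                   <= sg i * (p i (x *m A) - p i x)].
Proof.
move=> n_gt0 hyp; have [Q [T [Qu trT AQ eT]]] := triangular_coordinates A n_gt0.
pose nc := @Normc.normc R.
pose p i x := nc (cdot (col i Q^T) x).
pose t i := nc (T i i).
pose sg i : R := if 1 < t i then 1 else -1.
have [|d d_gt0 d_le] := @finite_pos_lower_bound R _ (fun i => `|t i - 1|).
  move=> i; rewrite normr_gt0 subr_eq0; apply: contra (hyp _ (eT i)) => /eqP ti.
  by rewrite -[`|_|]/((Normc.normc _)%:C)%C -/nc -/(t i) ti.
pose M := \sum_i \sum_j nc (T i j).
pose W := invmx Q^T.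
pose K := 1 + \sum_j \sum_k nc (W j k).
have nc_ge0 z : 0 <= nc z by exact: normc_ge0.
have M_ge i j : nc (T i j) <= M.
  apply: le_trans (ler_sum_term j _) (ler_sum_term i _) => // k.
  exact: sumr_ge0.
exists p, sg, d, M, K.
have sp i : seminorm (p i) by exact: seminorm_cdot.
split=> //.
- by move=> i; rewrite /sg; case: ifP; rewrite ?normrN normr1.
- split=> //; first by rewrite /M; do 2!(apply: sumr_ge0 => ? _).
  by rewrite ltr_pwDl//; do 2!(apply: sumr_ge0 => ? _).
- move=> x; set z := map_mx (real_complex R) x *m Q^T.
  have zE j : z 0 j = cdot (col j Q^T) x.
    by rewrite /z/cdot !mxE; apply: eq_bigr => k _; rewrite !mxE.
  have xE k : (x 0 k)%:C%C = \sum_j z 0 j * W j k.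
    have : map_mx (real_complex R) x = z *m W by rewrite mulmxK ?unitmx_tr.
    by move/matrixP/(_ 0 k); rewrite !mxE.
  rewrite mulr_sumr.
  have : norm1 x <= \sum_k \sum_j p j x * nc (W j k).
    apply: ler_sum => k _; rewrite -normc_real xE.
    apply: le_trans (normc_sum _) _; apply: ler_sum => j _.
    by rewrite Normc.normcM zE.
  move/le_trans; apply; rewrite exchange_big; apply: ler_sum => j _.
  rewrite -mulr_sumr mulrC ler_wpM2r ?nc_ge0//.
  apply: ler_wpDl => //.
  apply: (@ler_sum_term _ _ (fun j => \sum_k nc (W j k))) => ?.
  exact: sumr_ge0.
- move=> i x.
  pose z := map_mx (real_complex R) x *m Q^T.
  pose s := \sum_(j < n | (j < i)%N) T i j * z 0 j.
  have zE y j : cdot (col j Q^T) y = (map_mx (real_complex R) y *m Q^T) 0 j.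
    by rewrite /cdot colE mulmxA -colE mxE.
  have zA : cdot (col i Q^T) (x *m A) = T i i * cdot (col i Q^T) x + s.
    rewrite !zE map_mxM -/(cmx A) -mulmxA AQ mulmxA -/z.
    exact: mulmx_trig_coord.
  have s_le : nc s <= M * \sum_(j < n | (j < i)%N) p j x.
    rewrite mulr_sumr /s big_mkcond/= [leRHS]big_mkcond/=.
    apply: le_trans (normc_sum _) _; apply: ler_sum => j _.
    by case: ifP => _; rewrite ?Normc.normc0// Normc.normcM /p zE ler_wpM2r.
  have up : p i (x *m A) <= t i * p i x + nc s.
    by rewrite /p zA -Normc.normcM; exact: normcD.
  have lo : t i * p i x <= p i (x *m A) + nc s.
    have -> : t i * p i x = nc (cdot (col i Q^T) (x *m A) - s).
      by rewrite zA addrK; apply/esym/Normc.normcM.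
    by apply: le_trans (normcD _ _) _; rewrite normcN.
  have := ler_wpM2r (nc_ge0 _ : 0 <= p i x) (d_le i).
  rewrite /sg; case: ltP => ht.
    by rewrite gtr0_norm ?subr_gt0//; lra.
  by rewrite ler0_norm ?subr_le0//; lra.
Qed.

(* Geometric weights [e ^+ i] make the diagonal part of the triangular
   dynamics dominate the off-diagonal part. *)
Lemma hyperbolic_lyapunov (R : realType) n (A : 'M[R]_n) :
  (0 < n)%N -> (forall z, eigenvalue_of A z -> `|z| != 1) ->
  exists (G : 'rV[R]_n -> R) (L d : R), [/\ 0 <= L, 0 < d,
    forall x y, `|G x - G y| <= L * norm1 (x - y) &
    forall x, G x + d * norm1 x <= G (x *m A)].
Proof.
move=> n_gt0 /(triangular_drift n_gt0)[p [sg [d [M [K []]]]]].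
move=> sp sg1 [d_gt0 M_ge0 K_gt0] normK drift.
(* This value makes [M * n * e] at most [d / 2], so that the off-diagonal terms cost at most half of
   the diagonal growth. *)
pose e := d / (2 * M * n%:R + d).
have Mn_ge0 : 0 <= 2 * M * n%:R by rewrite !mulr_ge0.
have D_gt0 : 0 < 2 * M * n%:R + d by rewrite ltr_wpDl.
have e_gt0 : 0 < e by rewrite divr_gt0.
have e_ge0 := ltW e_gt0.
have e_le1 : e <= 1 by rewrite ler_pdivrMr// mul1r lerDr.
have MeD : 2 * (M * n%:R * e) <= d.
  have eD : e * (2 * M * n%:R + d) = d by rewrite divfK// gt_eqF.
  rewrite -[leRHS]eD.
  have -> : 2 * (M * n%:R * e) = e * (2 * M * n%:R) by ring.
  by rewrite ler_pM2l// lerDl ltW.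
have p_ge0 i x : 0 <= p i x by exact: seminorm_ge0.
pose G x := \sum_i sg i * e ^+ i * p i x.
have /choice[C CP] i : exists C : R, 0 <= C /\ forall x, p i x <= C * norm1 x.
  by have [C] := seminorm_bound (sp i); exists C.
exists G, (\sum_i C i), (d / 2 * e ^+ n / K); split.
- by apply: sumr_ge0 => i _; case: (CP i).
- by rewrite !mulr_gt0 ?invr_gt0 ?exprn_gt0.
- move=> x y; rewrite -sumrB mulr_suml; apply: le_trans (ler_norm_sum _ _ _) _.
  apply: ler_sum => i _; rewrite -mulrBr !normrM sg1 mul1r.
  rewrite ger0_norm ?exprn_ge0//.
  apply: (le_trans _ ((CP i).2 _)); apply: (le_trans _ (seminorm_dist (sp i) x y)).
  by rewrite ler_piMl// exprn_ile1.
move=> x; rewrite -lerBrDl -sumrB.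
pose S := \sum_(i < n) e ^+ i * p i x.
have S_lo : e ^+ n * (K^-1 * norm1 x) <= S.
  have : e ^+ n * \sum_i p i x <= S.
    rewrite mulr_sumr; apply: ler_sum => i _; rewrite ler_wpM2r//.
    by rewrite ler_wiXn2l// ltnW.
  by apply: le_trans; rewrite ler_wpM2l ?exprn_ge0// mulrC ler_pdivrMr// mulrC.
have S_up : \sum_(i < n) e ^+ i * (d * p i x - M * \sum_(j < n | (j < i)%N) p j x)
   <= \sum_i (sg i * e ^+ i * p i (x *m A) - sg i * e ^+ i * p i x).
  apply: ler_sum => i _; rewrite -mulrBr -[_ * e ^+ i]mulrC -mulrA ler_wpM2l//.
  by rewrite exprn_ge0.
apply: le_trans S_up.
(* For [j < i] the weight [e ^+ i] is at most [e] times the weight [e ^+ j] that coordinate [j]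
   carries in [S]. *)
have S_off : \sum_(i < n) e ^+ i * \sum_(j < n | (j < i)%N) p j x <= n%:R * (e * S).
  rewrite -[n in n%:R]card_ord -sumr_const mulr_suml; apply: ler_sum => i _.
  rewrite mul1r /S !mulr_sumr big_mkcond/=; apply: ler_sum => j _.
  rewrite mulrA; case: ifP => ji; last first.
    by apply: mulr_ge0=> //; apply: mulr_ge0 => //; exact: exprn_ge0.
  by rewrite ler_wpM2r// -exprS ler_wiXn2l.
have -> : \sum_(i < n) e ^+ i * (d * p i x - M * \sum_(j < n | (j < i)%N) p j x)
   = d * S - M * \sum_(i < n) e ^+ i * \sum_(j < n | (j < i)%N) p j x.
  by rewrite /S !mulr_sumr -sumrB; apply: eq_bigr => i _; ring.
have S_ge0 : 0 <= S by apply: sumr_ge0 => i _; rewrite mulr_ge0 ?exprn_ge0.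
have h1 := ler_wpM2l M_ge0 S_off.
have h2 := ler_wpM2r S_ge0 MeD.
have h3 := ler_wpM2l (ltW d_gt0) S_lo.
have -> : d / 2 * e ^+ n / K * norm1 x = d * (e ^+ n * (K^-1 * norm1 x)) / 2 by ring.
have h4 : M * (n%:R * (e * S)) = M * n%:R * e * S by ring.
rewrite h4 in h1.
lra.
Qed.

Lemma eigenvalue_of_tr (R : realType) n (A : 'M[R]_n) z :
  eigenvalue_of A z -> exists2 xi : 'cV[R[i]]_n, xi != 0 & cmx A *m xi = z *: xi.
Proof.
move=> Az; have : eigenvalue (cmx A)^T z.
  rewrite eigenvalue_root_char; move: Az.
  rewrite /eigenvalue_of /char_poly /char_poly_mx.
  by rewrite -det_tr linearB/= map_trmx tr_scalar_mx.
case/eigenvalueP => v vA v0; exists v^T; first by rewrite trmx_eq0.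
by rewrite -[cmx A]trmxK -trmx_mul vA linearZ.
Qed.

(** [H] is the modulus of the pairing with a right eigenvector for an unstable eigenvalue [z], and
    [lam] is the modulus of [z]. The real part [u] of the eigenvector is scaled to length 1; it is
    orthogonal to [mu] because [mu A = 0] and [z] is nonzero. This makes [u] an admissible test
    direction in the noise condition. *)
Lemma unstable_seminorm (R : realType) n (A : 'M[R]_n) (mu : 'rV[R]_n) :
  mu *m A = 0 -> (exists z, eigenvalue_of A z /\ 1 < `|z|) ->
  exists (H : 'rV[R]_n -> R) (u : 'rV[R]_n) (lam : R),
    [/\ seminorm H, 1 < lam, forall x, H (x *m A) = lam * H x
      & [/\ \sum_j u 0 j ^+ 2 = 1, (mu *m u^T) 0 0 = 0
          & forall x, `|(x *m u^T) 0 0| <= H x]].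
Proof.
move=> muA [z [/eigenvalue_of_tr[xi0 xi0_neq0 Axi0]]].
rewrite -[`|_|]/((Normc.normc _)%:C)%C -[1]/(1%:C)%C ltcR => z_gt1.
(* If the chosen nonzero entry is purely imaginary, multiplying the eigenvector by [i] gives it a
   nonzero real part. *)
have [xi1 Axi1 re1] : exists2 xi1 : 'cV[R[i]]_n, cmx A *m xi1 = z *: xi1
    & exists j, complex.Re (xi1 j 0) != 0.
  have [j xij] : exists j, xi0 j 0 != 0.
    apply/existsP; rewrite -negb_forall; apply: contra xi0_neq0 => /forallP h.
    by apply/eqP/colP => j; rewrite mxE; apply/eqP.
  have [re0|re0] := eqVneq (complex.Re (xi0 j 0)) 0; last by exists xi0 => //; exists j.
  exists (('i)%C *: xi0); first by rewrite -scalemxAr Axi0 !scalerA mulrC.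
  exists j; rewrite mxE mulrC ReiNIm oppr_eq0; apply: contra xij => /eqP im0.
  by rewrite [xi0 j 0]complexE re0 im0 mulr0 addr0.
pose S := \sum_j complex.Re (xi1 j 0) ^+ 2.
have S_gt0 : 0 < S.
  case: re1 => j rej; rewrite /S (bigD1 j)//= ltr_pwDl ?sumr_ge0//.
    by rewrite exprn_even_gt0.
  by move=> k _; rewrite sqr_ge0.
pose s := Num.sqrt S; have s_gt0 : 0 < s by rewrite sqrtr_gt0.
pose xi := (s^-1)%:C%C *: xi1.
have Axi : cmx A *m xi = z *: xi.
  by rewrite /xi -scalemxAr Axi1 !scalerA mulrC.
pose u := (map_mx (@complex.Re R) xi)^T.
have uE j : u 0 j = s^-1 * complex.Re (xi1 j 0).
  by rewrite !mxE; case: (xi1 j 0) => a b /=; rewrite mul0r subr0.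
exists (fun x => Normc.normc (cdot xi x)), u, (Normc.normc z).
have eig x : cdot xi (x *m A) = z * cdot xi x.
  by rewrite /cdot map_mxM -mulmxA -/(cmx A) Axi -scalemxAr mxE.
split=> //; first exact: seminorm_cdot.
  by move=> x; rewrite eig Normc.normcM.
have z0 : z != 0.
  by apply: contraTneq z_gt1 => ->; rewrite Normc.normc0 ltr10.
split.
- transitivity (s^-1 ^+ 2 * S); last first.
    by rewrite exprVn sqr_sqrtr ?(ltW S_gt0)// mulVf// gt_eqF.
  by rewrite mulr_sumr; apply: eq_bigr => j _; rewrite uE exprMn.
- rewrite trmxK -Re_cdot; have := eig mu.
  rewrite muA {1}/cdot map_mx0 mul0mx mxE => /esym/eqP.
  by rewrite mulf_eq0 (negbTE z0)/= => /eqP->.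
- by move=> x; rewrite trmxK -Re_cdot normr_Re_le.
Qed.

(** * Strict complementarity for the LP relaxation *)

(** A nonzero left kernel vector supported on [B] would make the objective negative together with
    its opposite. Hence the rows of [A] in [B] are independent, and by the rank bound they span the
    row space. Solving the equations on [B] then already determines the slack of every other row. *)
Lemma lp_strict_dual (R : realFieldType) p q (A : 'M[R]_(p, q)) (r : 'cV[R]_p)
    (B : {set 'I_p}) :
  (\rank A <= #|B|)%N ->
  (forall d : 'rV_p, d *m A = 0 -> d != 0 ->
     (forall i, i \notin B -> 0 <= d 0 i) -> (d *m r) 0 0 < 0) ->
  exists w : 'cV_q, (forall i, i \in B -> (A *m w) i 0 = r i 0) /\
                    (forall i, i \notin B -> r i 0 < (A *m w) i 0).
Proof.
move=> rkA neg; pose f : 'I_#|B| -> 'I_p := fun k => enum_val k.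
pose E : 'M[R]_(#|B|, p) := \matrix_(k, i) (f k == i)%:R.
have f_inj : injective f by exact: enum_val_inj.
have fB k : f k \in B by exact: enum_valP.
have EM m (M : 'M[R]_(p, m)) k j : (E *m M) k j = M (f k) j.
  rewrite mxE (bigD1 (f k))//= mxE eqxx mul1r big1 ?addr0// => i ik.
  by rewrite mxE eq_sym (negbTE ik) mul0r.
have Eoff (v : 'rV_#|B|) i : i \notin B -> (v *m E) 0 i = 0.
  move=> iB; rewrite mxE big1// => k _; rewrite mxE; case: eqVneq => [fk|]; last by rewrite mulr0.
  by rewrite -fk fB in iB.
have freeEA : row_free (E *m A).
  apply: inj_row_free => v vEA; have vE0 : v *m E = 0.
    apply: contraTeq isT => vE0; rewrite mulmxA in vEA.
    have h1 := neg (v *m E) vEA vE0.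
    have := neg (- (v *m E)); rewrite mulNmx vEA oppr0 oppr_eq0 => /(_ erefl vE0) h2.
    have {}h1 : (v *m E *m r) 0 0 < 0 by apply: h1 => i iB; rewrite Eoff.
    have {}h2 : (- (v *m E) *m r) 0 0 < 0 by apply: h2 => i iB; rewrite mxE Eoff ?oppr0.
    by move: h2; rewrite mulNmx mxE oppr_lt0 => /(lt_trans h1); rewrite ltxx.
  apply/rowP => k; have := congr1 (fun M : 'rV_p => M 0 (f k)) vE0.
  rewrite !mxE (bigD1 k)//= !mxE eqxx mulr1 big1 ?addr0// => j jk.
  by rewrite mxE (inj_eq f_inj) (negbTE jk) mulr0.
have AEA : (A <= E *m A)%MS.
  have := mxrank_leqif_sup (submxMl E A) => -[le <-].
  by rewrite eqn_leq le; move/eqP: (freeEA) => ->.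
pose w := pinvmx (E *m A) *m (E *m r).
have EAw : E *m A *m w = E *m r by rewrite /w mulmxA mulmxVp// mul1mx.
exists w; split=> i iB.
  have [k ->] : exists k, i = f k.
    by exists (enum_rank_in iB i); rewrite /f enum_rankK_in.
  by have := congr1 (fun M : 'cV_#|B| => M k 0) EAw; rewrite -mulmxA !EM.
have /submxP[u rowu] : (row i A <= E *m A)%MS.
  exact: submx_trans (row_sub _ _) AEA.
(* Row [i] is the combination [u] of the rows in [B], so [d] is in the left kernel and its only
   nonzero entry outside [B] is 1 at [i]. Negativity of its objective is the strict inequality at
   [i]. *)
pose d : 'rV[R]_p := delta_mx 0 i - u *m E.
have dA : d *m A = 0 by rewrite mulmxBl -rowE rowu mulmxA subrr.
have dE j : j \notin B -> d 0 j = (j == i)%:R.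
  by move=> jB; rewrite /d mxE [X in _ + X]mxE Eoff// subr0 mxE.
have := neg d dA; have -> : d != 0.
  by apply: contraTneq isT => d0; move: (dE i iB); rewrite d0 mxE eqxx => /eqP; rewrite eq_sym oner_eq0.
move=> /(_ isT) h.
have : (d *m r) 0 0 < 0.
  by apply: h => j jB; rewrite dE.
rewrite mulmxBl -rowE mxE [X in X + _]mxE [X in _ + X]mxE subr_lt0.
by rewrite -mulmxA -EAw mulmxA -rowu -row_mul mxE.
Qed.

Lemma sum_enum_val (R : realFieldType) n (F : 'I_n -> bool -> R) :
  \sum_(i < #|{: 'I_n * bool}|) F (enum_val i).1 (enum_val i).2 = \sum_s \sum_a F s a.
Proof.
rewrite pair_bigA/= [RHS](reindex (@enum_val _ {: 'I_n * bool}))//.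
exact: onW_bij (enum_val_bij _).
Qed.

Section Sharp.
Variables (R : realType) (n : nat) (P : 'I_n -> bool -> 'I_n -> R).
Variables (r : 'I_n -> bool -> R) (alpha : R) (y : 'I_n -> bool -> R) (st : 'I_n).
Hypothesis kerP : stochastic_kernel P.
Hypothesis opt : LPoptimal P r alpha y.
Hypothesis uniq_opt : forall y', LPoptimal P r alpha y' -> forall s a, y' s a = y s a.
Hypothesis y_visit : forall s, 0 < y s true + y s false.
Hypothesis y_st : forall a, 0 < y st a.

(** A short step from [y] along [d] stays feasible. Optimality of [y] excludes a gain, and
    uniqueness excludes a tie because [d] is nonzero. *)
Lemma lp_direction (d : 'I_n -> bool -> R) :
  (forall j, \sum_s \sum_a d s a * (P s a j - (s == j)%:R) = 0) ->
  \sum_s \sum_a d s a * a%:R = 0 -> \sum_s \sum_a d s a = 0 ->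
  (forall s a, ~~ (0 < y s a) -> 0 <= d s a) ->
  (exists s a, d s a != 0) -> \sum_s \sum_a r s a * d s a < 0.
Proof.
move=> dbal dbud dsum d_off [s0 [a0 d0]]; have [[y_ge0 ybud ybal ysum] ymax] := opt.
(* [e] bounds the positive entries of [y] from below; the default 1 at the others is harmless, since
   [d] is nonnegative there. *)
have [|e e_gt0 e_le] := @finite_pos_lower_bound R ('I_n * bool)%type
    (fun x => if 0 < y x.1 x.2 then y x.1 x.2 else 1).
  by move=> x; case: ifP.
pose D := 1 + \sum_s \sum_a `|d s a|.
have D_ge s a : `|d s a| <= D.
  rewrite ler_wpDl//; apply: le_trans (ler_sum_term s _); first exact: (@ler_sum_term _ _ (fun a => `|d s a|)).
  by move=> ?; exact: sumr_ge0.
have D_gt0 : 0 < D by rewrite ltr_pwDl//; do 2!(apply: sumr_ge0 => ? _).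
pose t := e / D; have t_gt0 : 0 < t by rewrite divr_gt0.
have t_le s a : t * `|d s a| <= e.
  by rewrite /t mulrAC ler_pdivrMr// ler_pM2l.
pose y' s a := y s a + t * d s a.
have sumE (F : 'I_n -> bool -> R) :
    \sum_s \sum_a F s a * y' s a = \sum_s \sum_a F s a * y s a + t * \sum_s \sum_a F s a * d s a.
  rewrite mulr_sumr -big_split; apply: eq_bigr => s _.
  rewrite mulr_sumr -big_split; apply: eq_bigr => a _ /=.
  by rewrite /y'; ring.
have objE : LPobj r y' = LPobj r y + t * \sum_s \sum_a r s a * d s a by exact: sumE.
have feas : LPfeasible P alpha y'.
  split.
  - move=> s a; rewrite /y'; case: (boolP (0 < y s a)) => [ys|ys].
      have := e_le (s, a); rewrite /= ys => ey.
      have := ler_norm (- d s a); rewrite normrN => dn.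
      have := t_le s a; have := ler_wpM2l (ltW t_gt0) dn; lra.
    by rewrite addr_ge0// mulr_ge0 ?d_off// ltW.
  - have := sumE (fun _ (a : bool) => a%:R).
    have -> : \sum_s \sum_(a : bool) a%:R * d s a = 0.
      rewrite -[RHS]dbud; apply: eq_bigr => s _; apply: eq_bigr => a _; exact: mulrC.
    rewrite mulr0 addr0 => h; rewrite -ybud.
    have E (z : 'I_n -> bool -> R) : \sum_s \sum_(a : bool) a%:R * z s a = \sum_s z s true.
      by apply: eq_bigr => s _; rewrite big_bool/= mul1r mul0r addr0.
    by rewrite -!E.
  - move=> j; have := sumE (fun s a => P s a j - (s == j)%:R).
    have -> : \sum_s \sum_a (P s a j - (s == j)%:R) * d s a = 0.
      rewrite -[RHS](dbal j); apply: eq_bigr => s _; apply: eq_bigr => a _; exact: mulrC.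
    have E (z : 'I_n -> bool -> R) : \sum_s \sum_a (P s a j - (s == j)%:R) * z s a
        = \sum_s \sum_a z s a * P s a j - \sum_a z j a.
      rewrite [X in _ - X](_ : _ = \sum_s \sum_a (s == j)%:R * z s a).
        rewrite -sumrB; apply: eq_bigr => s _; rewrite -sumrB; apply: eq_bigr => a _.
        by ring.
      rewrite [RHS](bigD1 j)//= eqxx [X in _ = _ + X]big1 ?addr0 => [|s sj].
        by apply: eq_bigr => a _; rewrite mul1r.
      by rewrite (negbTE sj) big1// => a _; rewrite mul0r.
    by rewrite !E (ybal j) subrr mulr0 addr0 => /eqP; rewrite subr_eq0 => /eqP.
  - have := sumE (fun _ _ => 1).
    have E (z : 'I_n -> bool -> R) : \sum_s \sum_a 1 * z s a = \sum_s \sum_a z s a.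
      by apply: eq_bigr => s _; apply: eq_bigr => a _; rewrite mul1r.
    by rewrite !E dsum mulr0 addr0 ysum.
have obj_le : \sum_s \sum_a r s a * d s a <= 0.
  by have := ymax y' feas; rewrite objE gerDl pmulr_rle0.
rewrite lt_neqAle obj_le andbT; apply/eqP => obj0.
have : y' s0 a0 = y s0 a0.
  apply: uniq_opt; split=> // z /ymax; by rewrite objE obj0 mulr0 addr0.
by move/eqP; rewrite -subr_eq0 addrAC subrr add0r mulf_eq0 (negbTE d0) gt_eqF.
Qed.

(** Each of the [n] states has at least one action in the support, and [st] has both. *)
Lemma card_lp_support :
  (n.+1 <= #|[set x : 'I_n * bool | (0 < y x.1 x.2)%R]|)%N.
Proof.
pose b s := 0 < y s true.
pose S := (st, false) |: [set (s, b s) | s : 'I_n].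
have inS : (st, false) \notin [set (s, b s) | s : 'I_n].
  by apply/imsetP => -[s _ []] <-; rewrite /b y_st.
have <- : #|S| = n.+1.
  by rewrite cardsU1 inS card_imset ?card_ord// => s s' [].
apply/subset_leq_card/subsetP => x; rewrite !inE => /orP[/eqP->|]; first exact: y_st.
move=> /imsetP[s _ ->]/=; rewrite /b; case: (ltP 0 (y s true)) => // ys.
by have := y_visit s; lra.
Qed.

(** [h] is a relative value function, [lam] the price of an activation, [g] the multiplier of the
    total mass, and [rho] the reduced cost. Strict positivity of [rho] off the support is what
    charges every bad arm. *)
Lemma lp_strict_complementarity :
  exists (h : 'I_n -> R) (lam g : R) (rho : 'I_n -> bool -> R),
  [/\ forall s a, r s a + rho s a = \sum_j P s a j * h j - h s + a%:R * lam + g,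
      forall s a, 0 < y s a -> rho s a = 0
    & forall s a, ~~ (0 < y s a) -> 0 < rho s a].
Proof.
pose p := #|{: 'I_n * bool}|.
pose en (i : 'I_p) : 'I_n * bool := enum_val i.
have enK x : en (enum_rank x) = x by exact: enum_rankK.
have enV i : enum_rank (en i) = i by exact: enum_valK.
pose Bal : 'M[R]_(p, n) := \matrix_(i, j) (P (en i).1 (en i).2 j - ((en i).1 == j)%:R).
pose Bud : 'cV[R]_p := \col_i ((en i).2)%:R.
pose One : 'cV[R]_p := const_mx 1.
pose A := row_mx Bal (row_mx Bud One).
pose B' := [set x : 'I_n * bool | (0 < y x.1 x.2)%R].
pose B := [set i : 'I_p | en i \in B'].
pose rv : 'cV[R]_p := \col_i r (en i).1 (en i).2.
have cardB : #|B| = #|B'|.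
  rewrite -(card_imset _ (@enum_rank_inj {: 'I_n * bool})); suff -> : B = enum_rank @: B' by [].
  apply/setP => i.
  apply/idP/imsetP => [|[x xB ->]]; last by rewrite inE enK.
  rewrite inE => iB.
  by exists (en i) => //; rewrite enV.
have rkA : (\rank A <= #|B|)%N.
  (* The balance constraints add up to zero because transition rows sum to 1. So the [n + 2] columns
     have rank at most [n + 1], which the size of the support matches. *)
  pose c : 'cV[R]_(n + (1 + 1)) := col_mx (const_mx 1) 0.
  have Ac : A *m c = 0.
    rewrite mul_row_col mulmx0 addr0; apply/colP => i; rewrite !mxE.
    under eq_bigr => j _ do rewrite !mxE mulr1.
    rewrite sumrB kerP.2 (bigD1 (en i).1)//= eqxx big1 ?addr0 ?subrr// => j.
    by rewrite eq_sym => /negbTE->.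
  have c0 : c != 0.
    apply/eqP => /colP/(_ (lshift _ st)); rewrite col_mxEu !mxE => /eqP.
    by rewrite oner_eq0.
  have := mulmx0_rank_max Ac.
  have -> : \rank c = 1%N.
    by apply/eqP; rewrite eqn_leq rank_leq_col lt0n mxrank_eq0.
  move=> h; rewrite cardB; apply: leq_trans card_lp_support.
  by rewrite -ltnS -(addn1 (\rank A)); apply: leq_trans h _; rewrite addnA !addn1.
have [|w [w_eq w_lt]] := @lp_strict_dual _ _ _ A rv B rkA.
  (* The left kernel of [A] consists of the directions that preserve balance, budget and total
     mass. *)
  move=> d dA d0 d_off.
  pose dd s a := d 0 (enum_rank (s, a)).
  have dE i : d 0 i = dd (en i).1 (en i).2.
    by rewrite /dd -surjective_pairing enV.
  move: dA; rewrite !mul_mx_row => /eqP; rewrite !row_mx_eq0 => /and3P[/eqP dBal /eqP dBud /eqP dOne].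
  have -> : (d *m rv) 0 0 = \sum_s \sum_a r s a * dd s a.
    by rewrite -(sum_enum_val (fun s a => r s a * dd s a)) mxE; apply: eq_bigr => i _; rewrite mxE dE mulrC.
  apply: lp_direction.
  - move=> j; move/rowP/(_ j): dBal; rewrite !mxE => h; rewrite -[RHS]h.
    rewrite -(sum_enum_val (fun s a => dd s a * (P s a j - (s == j)%:R))).
    by apply: eq_bigr => i _; rewrite mxE dE.
  - move/rowP/(_ 0): dBud; rewrite !mxE => h; rewrite -[RHS]h -(sum_enum_val (fun s a => dd s a * a%:R)).
    by apply: eq_bigr => i _; rewrite mxE dE.
  - move/rowP/(_ 0): dOne; rewrite !mxE => h; rewrite -[RHS]h -(sum_enum_val dd).
    by apply: eq_bigr => i _; rewrite mxE dE mulr1.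
  - by move=> s a ysa; apply: d_off; rewrite /B !inE enK.
  - have [i di] : exists i, d 0 i != 0.
      apply/existsP; rewrite -negb_forall; apply: contra d0 => /forallP h.
      by apply/eqP/rowP => i; rewrite mxE; apply/eqP.
    by exists (en i).1, (en i).2; rewrite -dE.
pose h j := w (lshift _ j) 0.
pose lam := w (rshift n (lshift 1 0)) 0.
pose g := w (rshift n (rshift 1 0)) 0.
pose rho s a := \sum_j P s a j * h j - h s + a%:R * lam + g - r s a.
have AwE s a : (A *m w) (enum_rank (s, a)) 0 = \sum_j P s a j * h j - h s + a%:R * lam + g.
  rewrite -[w]vsubmxK mul_row_col -[dsubmx w]vsubmxK mul_row_col !mxE addrA.
  rewrite !big_ord1 !mxE enK/= mul1r; congr (_ + _ + _).
  under eq_bigr => j _ do rewrite !mxE enK/= mulrBl.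
  rewrite sumrB; congr (_ - _).
  rewrite (bigD1 s)//= eqxx mul1r big1 ?addr0// => j.
  by rewrite eq_sym => /negbTE->; rewrite mul0r.
exists h, lam, g, rho; split=> s a.
- by rewrite /rho; ring.
- move=> ysa; have := w_eq (enum_rank (s, a)); rewrite /B !inE enK => /(_ ysa).
  by rewrite AwE mxE enK /rho => ->; rewrite subrr.
- move=> ysa; have := w_lt (enum_rank (s, a)); rewrite /B !inE enK => /(_ ysa).
  by rewrite AwE mxE enK /rho subr_gt0.
Qed.
End Sharp.

(** * Product laws and coupling *)

Section ProductLaw.
Variables (R : realType) (I T : finType).
Implicit Types (p q : I -> T -> R) (F : {ffun I -> T} -> R).

Definition distributions p : Prop :=
  (forall i t, 0 <= p i t) /\ (forall i, \sum_t p i t = 1).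

Definition Eprod p F : R := \sum_(w : {ffun I -> T}) (\prod_i p i (w i)) * F w.

Lemma Eprod_prod p (f : I -> T -> R) :
  Eprod p (fun w => \prod_i f i (w i)) = \prod_i \sum_t p i t * f i t.
Proof.
rewrite bigA_distr_bigA; apply: eq_bigr => w _.
by rewrite -big_split.
Qed.

Lemma EprodD p F1 F2 : Eprod p (fun w => F1 w + F2 w) = Eprod p F1 + Eprod p F2.
Proof. by rewrite -big_split; apply: eq_bigr => w _; rewrite mulrDr. Qed.

Lemma EprodZ p a F : Eprod p (fun w => a * F w) = a * Eprod p F.
Proof. by rewrite mulr_sumr; apply: eq_bigr => w _; rewrite mulrCA. Qed.

Lemma Eprod_sum (J : finType) p (F : J -> {ffun I -> T} -> R) :
  Eprod p (fun w => \sum_j F j w) = \sum_j Eprod p (F j).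
Proof.
by rewrite [RHS]exchange_big; apply: eq_bigr => w _; rewrite mulr_sumr.
Qed.

Section Dist.
Variable p : I -> T -> R.
Hypothesis dp : distributions p.

Lemma Eprod_cst a : Eprod p (fun=> a) = a.
Proof.
by rewrite /Eprod -mulr_suml -bigA_distr_bigA big1 ?mul1r// => i _; exact: dp.2.
Qed.

Lemma Eprod_le F1 F2 : (forall w, F1 w <= F2 w) -> Eprod p F1 <= Eprod p F2.
Proof.
move=> F12; apply: ler_sum => w _; rewrite ler_wpM2l// prodr_ge0// => i _.
exact: dp.1.
Qed.

(** Independence of two coordinates: the factors are extended by 1 to all other coordinates, and the
    product formula applies. *)
Lemma Eprod_coord2 i k (f g : T -> R) : i != k ->
  Eprod p (fun w => f (w i) * g (w k)) = (\sum_t p i t * f t) * (\sum_t p k t * g t).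
Proof.
move=> ik; have ki : (k == i) = false by rewrite eq_sym (negbTE ik).
pose h j t := (if j == i then f t else if j == k then g t else 1) : R.
have hE : (fun w : {ffun I -> T} => f (w i) * g (w k)) = fun w => \prod_j h j (w j).
  apply: boolp.funext => w; rewrite (bigD1 i)//= (bigD1 k) 1?eq_sym//= big1 ?mulr1.
    by rewrite /h !eqxx ki.
  by move=> j /andP[ji jk]; rewrite /h (negbTE ji) (negbTE jk).
rewrite hE Eprod_prod (bigD1 i)//= (bigD1 k) 1?eq_sym//= [X in _ * (_ * X)]big1 ?mulr1.
  by congr (_ * _); apply: eq_bigr => t _; rewrite /h ?ki eqxx.
move=> j /andP[ji jk]; rewrite /h (negbTE ji) (negbTE jk) -[RHS](dp.2 j).
by apply: eq_bigr => t _; rewrite mulr1.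
Qed.

Lemma Eprod_coord k (f : T -> R) :
  Eprod p (fun w => f (w k)) = \sum_t p k t * f t.
Proof.
pose h j t := (if j == k then f t else 1) : R.
have hE : (fun w : {ffun I -> T} => f (w k)) = fun w => \prod_j h j (w j).
  apply: boolp.funext => w; rewrite (bigD1 k)//= big1 ?mulr1 /h ?eqxx//.
  by move=> j jk; rewrite (negbTE jk).
rewrite hE Eprod_prod (bigD1 k)//= [X in _ * X]big1 ?mulr1.
  by apply: eq_bigr => t _; rewrite /h eqxx.
move=> j jk; rewrite /h (negbTE jk) -[RHS](dp.2 j).
by apply: eq_bigr => t _; rewrite mulr1.
Qed.

(** The mixed second moments vanish by independence, so the variance of the sum is at most the
    number of coordinates. *)
Lemma Eprod_norm_centered (g : I -> T -> R) :
  (forall i, \sum_t p i t * g i t = 0) -> (forall i t, `|g i t| <= 1) ->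
  (0 < #|I|)%N ->
  Eprod p (fun w => `|\sum_i g i (w i)|) <= Num.sqrt #|I|%:R.
Proof.
move=> g0 g1 I_gt0; set s := Num.sqrt _.
have s_gt0 : 0 < s by rewrite sqrtr_gt0 ltr0n.
have s2 : s ^+ 2 = #|I|%:R by rewrite sqr_sqrtr.
have var : Eprod p (fun w => (\sum_i g i (w i)) ^+ 2) <= s ^+ 2.
  have -> : Eprod p (fun w => (\sum_i g i (w i)) ^+ 2) =
            \sum_i \sum_k Eprod p (fun w => g i (w i) * g k (w k)).
    rewrite -[RHS](eq_bigr _ (fun i _ => Eprod_sum p _)) -Eprod_sum.
    apply: eq_bigr => w _; congr (_ * _); rewrite expr2 mulr_suml.
    by apply: eq_bigr => i _; rewrite mulr_sumr.
  rewrite s2 -sumr_const; apply: ler_sum => i _.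
  rewrite (bigD1 i)//= big1 ?addr0 => [|k ki]; last first.
    by rewrite Eprod_coord2 1?eq_sym// g0 mul0r.
  rewrite -[leRHS]Eprod_cst; apply: Eprod_le => w.
  by rewrite -expr2 -real_normK ?num_real// expr_le1.
(* AM-GM: [2 s |x| <= x ^ 2 + s ^ 2] *)
have amgm : 2 * s * Eprod p (fun w => `|\sum_i g i (w i)|) <=
    Eprod p (fun w => (\sum_i g i (w i)) ^+ 2) + s ^+ 2.
  rewrite -[X in _ + X]Eprod_cst -EprodD -EprodZ; apply: Eprod_le => w.
  set x := \sum_i _; have := sqr_ge0 (`|x| - s).
  rewrite sqrrB real_normK ?num_real// => h; lra.
have s2_gt0 : 0 < 2 * s by rewrite mulr_gt0.
rewrite -(ler_pM2l s2_gt0); apply: le_trans amgm _.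
by have -> : 2 * s * s = s ^+ 2 + s ^+ 2 by [ring]; rewrite lerD2r.
Qed.
End Dist.
End ProductLaw.

(** Push-forward of a product law along a coordinatewise map: the fibre over [w] is a product of
    fibres, so the sum over it factors. Used to read off both marginals of a coupling. *)
Lemma Eprod_image (R : realType) (I T U : finType) (q : I -> U -> R)
    (p : I -> T -> R) (phi : U -> T) (F : {ffun I -> T} -> R) :
  (forall i t, \sum_(x | phi x == t) q i x = p i t) ->
  Eprod q (fun v => F [ffun i => phi (v i)]) = Eprod p F.
Proof.
move=> qp; rewrite /Eprod.
rewrite (partition_big (fun v : {ffun I -> U} => [ffun i => phi (v i)]) xpredT)//=.
apply: eq_bigr => w _; under [in RHS]eq_bigr => i _ do rewrite -qp.
rewrite bigA_distr_big_dep mulr_suml; apply: eq_big => [v|v /eqP->//].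
apply/eqP/familyP => [<- i|h]; first by apply/eqP; rewrite ffunE.
by apply/ffunP => i; rewrite ffunE; apply/eqP; exact: h i.
Qed.

(** Under a coordinatewise coupling that keeps the coordinates outside [J] equal, at most [#|J|]
    coordinates differ. *)
Lemma Eprod_coupling (R : realType) (I T : finType) (p p' : I -> T -> R)
    (J : {set I}) (F : {ffun I -> T} -> R) (c : R) :
  distributions p -> distributions p' ->
  (forall i, i \notin J -> p i =1 p' i) -> 0 <= c ->
  (forall w w' : {ffun I -> T}, F w - F w' <= c * \sum_i (w i != w' i)%:R) ->
  Eprod p F - Eprod p' F <= c * #|J|%:R.
Proof.
move=> dp dp' pp' c_ge0 lipF.
(* Independent coupling on [J], diagonal coupling elsewhere. *)
pose q i (x : T * T) : R :=
  if i \in J then p i x.1 * p' i x.2 else (x.1 == x.2)%:R * p i x.1.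
have q1 i t : \sum_(x | x.1 == t) q i x = p i t.
  rewrite (reindex_onto (fun t' => (t, t')) snd)/=; last first.
    by move=> [a b]/= /eqP->.
  under eq_bigl do rewrite !eqxx/=.
  rewrite /q; case: (i \in J) => /=; first by rewrite -mulr_sumr dp'.2 mulr1.
  rewrite (bigD1 t)//= eqxx mul1r big1 ?addr0// => t' t't.
  by rewrite eq_sym (negbTE t't) mul0r.
have q2 i t : \sum_(x | x.2 == t) q i x = p' i t.
  rewrite (reindex_onto (fun t' => (t', t)) fst)/=; last first.
    by move=> [a b]/= /eqP->.
  under eq_bigl do rewrite !eqxx/=.
  rewrite /q; case: (boolP (i \in J)) => iJ /=; first by rewrite -mulr_suml dp.2 mul1r.
  rewrite (bigD1 t)//= eqxx mul1r big1 ?addr0 ?pp'// => t' t't.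
  by rewrite (negbTE t't) mul0r.
have dq : distributions q.
  split=> [i x|i].
    by rewrite /q; case: ifP => _; rewrite mulr_ge0 ?dp.1 ?dp'.1.
  rewrite (partition_big fst xpredT)//= -[RHS](dp.2 i).
  by apply: eq_bigr => t _; rewrite q1.
rewrite -(Eprod_image F q1) -(Eprod_image F q2).
rewrite -[X in _ - X]mul1r -mulNr -EprodZ -EprodD.
apply: le_trans (Eprod_le dq _) _.
  by move=> v; rewrite mulN1r; exact: lipF.
rewrite EprodZ ler_wpM2l// Eprod_sum -sumr_const [leRHS]big_mkcond/=.
apply: ler_sum => i _.
under eq_fun => v do rewrite !ffunE.
rewrite (Eprod_coord dq i (fun x => (x.1 != x.2)%:R)).
case: ifPn => iJ.
  rewrite -[leRHS](dq.2 i); apply: ler_sum => x _.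
  by rewrite ler_piMr ?dq.1// lern1; case: (_ != _).
rewrite big1// => x _; rewrite /q (negbTE iJ).
by case: eqVneq; rewrite ?mul0r ?mulr0.
Qed.

(** * Long-run averages *)

Section Averaging.
Variables (R : realType) (n : nat) (P : 'I_n -> bool -> 'I_n -> R).
Variables (r : 'I_n -> bool -> R) (N nb : nat) (pi : policy R n N) (S0 : Sn n N).
Hypothesis kerP : stochastic_kernel P.
Hypothesis vpi : valid_policy nb pi.

Definition reward (s : Sn n N) (a : An N) : R := N%:R^-1 * \sum_i r (s i) (a i).

Lemma PN_Eprod (s : Sn n N) (a : An N) (F : Sn n N -> R) :
  \sum_s' PN P s a s' * F s' = Eprod (fun i => P (s i) (a i)) F.
Proof. by []. Qed.

Lemma distributions_PN (s : Sn n N) (a : An N) : distributions (fun i => P (s i) (a i)).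
Proof. by split=> [i t|i]; [exact: kerP.1|exact: kerP.2]. Qed.

Lemma hprob_ge0 h s : 0 <= hprob P pi S0 h s.
Proof.
elim: h s => [|[s' a'] h IH] s /=; first by rewrite ler0n.
rewrite !mulr_ge0//; first by case: vpi.
by apply: prodr_ge0 => i _; exact: kerP.1.
Qed.

Lemma sum_tuple_cons (T : finType) t (F : seq T -> R) :
  \sum_(h : t.+1.-tuple T) F h = \sum_(h : t.-tuple T) \sum_x F (x :: h).
Proof.
rewrite exchange_big pair_bigA/=.
rewrite (reindex (fun u : T * t.-tuple T => [tuple of u.1 :: u.2]))//.
exists (fun h => (thead h, [tuple of behead h])) => [[x h] _|h _].
  by congr (_, _); apply: val_inj.
by rewrite [RHS]tuple_eta; apply: val_inj.
Qed.

Definition expect (F : Sn n N -> R) t : R :=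
  \sum_(h : t.-tuple (Sn n N * An N)) \sum_s hprob P pi S0 h s * F s.

(** Histories are stored most recent first, so removing the head of a history of length [t.+1]
    exposes the last transition. *)
Lemma expect_step F t : expect F t.+1 =
  \sum_(h : t.-tuple (Sn n N * An N)) \sum_s \sum_a
    hprob P pi S0 h s * pi h s a * \sum_s' PN P s a s' * F s'.
Proof.
rewrite /expect (sum_tuple_cons _ (fun h => \sum_s hprob P pi S0 h s * F s)).
apply: eq_bigr => h _; rewrite [RHS]pair_bigA/=; apply: eq_bigr => -[s a] _ /=.
by rewrite mulr_sumr; apply: eq_bigr => s' _; rewrite !mulrA.
Qed.

Lemma expect_policy F t : expect F t =
  \sum_(h : t.-tuple (Sn n N * An N)) \sum_s \sum_a hprob P pi S0 h s * pi h s a * F s.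
Proof.
apply: eq_bigr => h _; apply: eq_bigr => s _.
by rewrite -mulr_suml -mulr_sumr; case: vpi => _ -> _; rewrite mulr1.
Qed.

Lemma expect_cst a t : expect (fun=> a) t = a.
Proof.
elim: t => [|t IH].
  rewrite /expect (big_pred1 [tuple])/=; last by move=> h; apply/esym/eqP; exact: tuple0.
  rewrite (bigD1 S0)//= eqxx mul1r big1 ?addr0// => s /negbTE ->.
  by rewrite mul0r.
rewrite -[RHS]IH expect_step expect_policy; apply: eq_bigr => h _; apply: eq_bigr => s _.
apply: eq_bigr => u _; rewrite PN_Eprod Eprod_cst//.
exact: distributions_PN.
Qed.

(** The bound does not depend on [t]; this makes the boundary terms of the telescoping sum vanish in
    the long-run average. *)
Lemma expect_bound F t : `|expect F t| <= \sum_s `|F s|.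
Proof.
rewrite -[leRHS](expect_cst _ t); apply: le_trans (ler_norm_sum _ _ _) _.
apply: ler_sum => h _; apply: le_trans (ler_norm_sum _ _ _) _.
apply: ler_sum => s _; rewrite normrM ger0_norm ?hprob_ge0// ler_wpM2l ?hprob_ge0//.
exact: (@ler_sum_term _ _ (fun s => `|F s|)).
Qed.

Variables (L k : R) (G : Sn n N -> R).
Hypothesis drift : forall s a, nactive a = nb ->
  k + reward s a <= L - G s + \sum_s' PN P s a s' * G s'.

(** The drift inequality is averaged over the law of history, state and action; action vectors
    violating the budget have probability 0. *)
Lemma exp_reward_le t :
  exp_reward P r pi S0 t <= L - k - expect G t + expect G t.+1.
Proof.
rewrite -(expect_cst (L - k) t) !(expect_policy _ t) expect_step /exp_reward.
rewrite -sumrB -big_split/=; apply: ler_sum => h _.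
rewrite -sumrB -big_split/=; apply: ler_sum => s _.
rewrite -sumrB -big_split/=; apply: ler_sum => a _.
rewrite -mulrBr -mulrDr; have [act|nact] := eqVneq (nactive a) nb; last first.
  by case: vpi => _ _ ->//; rewrite mulr0 !mul0r.
rewrite ler_wpM2l ?mulr_ge0 ?hprob_ge0//; first by case: vpi.
by have := drift s act; rewrite /reward; lra.
Qed.

(** Summing over time telescopes the potential [G], whose two boundary terms contribute [O(1 / T)]
    to the average. *)
Lemma avg_reward_le (l : R) : (avg_reward P r pi S0 @ \oo --> l)%classic -> k <= L - l.
Proof.
move=> cvl; rewrite lerBrDl -lerBrDr.
pose C := \sum_s `|G s|.
have avg_le T : avg_reward P r pi S0 T.+1 <= L - k + 2 * C * T.+1%:R^-1.
  have : \sum_(t < T.+1) exp_reward P r pi S0 t <= T.+1%:R * (L - k) + 2 * C.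
    have : \sum_(t < T.+1) exp_reward P r pi S0 t <=
           T.+1%:R * (L - k) + (expect G T.+1 - expect G 0).
      elim: T.+1 => [|m IH]; first by rewrite big_ord0 mul0r subrr addr0.
      rewrite big_ord_recr/=; have := exp_reward_le m.
      by rewrite -[in m.+1%:R]natr1 mulrDl mul1r; lra.
    have := expect_bound G T.+1; have := expect_bound G 0.
    rewrite !ler_norml -/C => /andP[? ?] /andP[? ?]; lra.
  move=> h; rewrite /avg_reward -(ler_pM2l (ltr0Sn R T)) mulVKf ?pnatr_eq0//.
  by rewrite mulrDr [X in _ + X]mulrCA mulfV ?pnatr_eq0// mulr1.
rewrite -[L - k]addr0 -[0 in leRHS](mulr0 (2 * C)).
have cv2 : ((L - k + 2 * C * T.+1%:R^-1) @[T --> \oo] --> L - k + 2 * C * 0)%classic.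
  by apply: cvgD; [exact: cvg_cst|apply: cvgMr; exact: cvg_harmonic].
apply: (ler_cvg_to _ cv2); last by apply: nearW; exact: avg_le.
by rewrite (cvg_shiftS (avg_reward P r pi S0)).
Qed.
End Averaging.

(** * One step of the N-armed system *)

Lemma exists_subset_card (I : finType) (U : {set I}) k :
  (k <= #|U|)%N -> exists2 V : {set I}, V \subset U & #|V| = k.
Proof.
move=> kU; exists [set x in take k (enum U)].
  by apply/subsetP => x; rewrite inE => /mem_take; rewrite mem_enum.
rewrite cardsE; have /card_uniqP -> := take_uniq k (enum_uniq U).
by rewrite size_takel// -cardE.
Qed.

(** The set [T] is only shrunk or only enlarged, so the change is the difference of the
    cardinalities; the sum of two truncated subtractions is its absolute value. *)
Lemma resize_subset (I : finType) (T U : {set I}) k :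
  T \subset U -> (k <= #|U|)%N ->
  exists V : {set I}, [/\ V \subset U, #|V| = k &
    #|(T :\: V) :|: (V :\: T)| = ((#|T| - k) + (k - #|T|))%N].
Proof.
move=> TU kU; have [kT|Tk] := leqP k #|T|.
  have [V VT cV] := exists_subset_card kT.
  exists V; split=> //; first exact: subset_trans TU.
  have /eqP -> : V :\: T == set0 by rewrite setD_eq0.
  by rewrite setU0 cardsD (setIidPr VT) cV (eqP kT) addn0.
have [|V VU cV] := @exists_subset_card _ (U :\: T) (k - #|T|).
  by rewrite cardsD (setIidPr TU) leq_sub2r.
have dis : T :&: V = set0.
  apply/setP => x; rewrite !inE; apply/andP => -[xT /(subsetP VU)].
  by rewrite inE xT.
exists (T :|: V); split.
- by rewrite subUset TU; apply: subset_trans VU (subsetDl _ _).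
- by rewrite cardsU dis cards0 subn0 cV subnKC// ltnW.
- have /eqP -> : T :\: (T :|: V) == set0 by rewrite setD_eq0 subsetUl.
  rewrite set0U setDUl setDv set0U cardsD setIC dis cards0 subn0 cV.
  by rewrite (eqP (ltnW Tk)) add0n.
Qed.

Section OneStep.
Variables (R : realType) (n : nat) (P : 'I_n -> bool -> 'I_n -> R).
Variables (alpha : R) (y : 'I_n -> bool -> R) (st : 'I_n).
Hypothesis kerP : stochastic_kernel P.
Hypothesis feas : LPfeasible P alpha y.
Hypothesis y_visit : forall s, 0 < y s true + y s false.
Hypothesis st_uniq : forall s, (0 < y s false) && (0 < y s true) <-> s = st.

Let y_ge0 s a : 0 <= y s a. Proof. by case: feas. Qed.

Lemma P_le1 s a j : P s a j <= 1.
Proof. by rewrite -(kerP.2 s a); apply: ler_sum_term => k; exact: kerP.1. Qed.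

Lemma pibarE a s : pibar y a s = y s a / (y s false + y s true).
Proof. by rewrite /pibar addrC y_visit addrC. Qed.

Lemma pibar_mass a s : (y s false + y s true) * pibar y a s = y s a.
Proof. by rewrite pibarE mulrC divfK// gt_eqF// addrC. Qed.

Lemma pibar_ge0 a s : 0 <= pibar y a s.
Proof. by rewrite pibarE divr_ge0// addr_ge0. Qed.

Lemma pibar_sum s : pibar y true s + pibar y false s = 1.
Proof. by rewrite !pibarE -mulrDl addrC divff// gt_eqF// addrC. Qed.

(** Only [st] has both actions in the support, so elsewhere the policy is deterministic. *)
Lemma pibar_off a s : s != st -> pibar y a s = (0 < y s a)%R%:R.
Proof.
move=> sst; have [ysa|ysa] := ltP 0 (y s a); last first.
  have : y s a = 0 by apply/eqP; rewrite eq_le ysa y_ge0.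
  by rewrite pibarE => ->; rewrite mul0r.
have ysna : y s (~~ a) = 0.
  apply/eqP; rewrite eq_le y_ge0 andbT leNgt; apply: contra sst => ysna.
  by apply/eqP/st_uniq; case: (a) ysa ysna => -> ->.
rewrite pibarE; case: (a) ysa ysna => /= ysa ->; rewrite ?add0r ?addr0 divff//;
by rewrite gt_eqF.
Qed.

Lemma mustar_Ppibar : mustar y *m Ppibar P y = mustar y.
Proof.
apply/rowP => j; rewrite !mxE; case: feas => _ _ /(_ j) bal _.
rewrite [RHS]addrC -[RHS](big_bool _ (fun a => y j a)) -bal.
apply: eq_bigr => s _; rewrite !mxE mulr_sumr; apply: eq_bigr => a _.
by rewrite mulrA pibar_mass.
Qed.

Lemma mustar_sum : \sum_s (y s false + y s true) = 1.
Proof.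
case: feas => _ _ _ <-; apply: eq_bigr => s _.
by rewrite big_bool addrC.
Qed.

(** [mustar] is stationary and has mass 1, which cancels the first two terms of [Phi]; its
    activation rate is [alpha], which kills the third. *)
Lemma mustar_Phi : mustar y *m Phi P alpha y st = 0.
Proof.
rewrite /Phi !mulmxBr mustar_Ppibar !mulmxA.
have -> : mustar y *m (ones R n)^T = 1%:M.
  apply/rowP => i; rewrite !mxE (ord1 i) eqxx -mustar_sum.
  by apply: eq_bigr => s _; rewrite !mxE mulr1.
rewrite mul1mx subrr.
have -> : mustar y *m (cvec y - alpha *: ones R n)^T = 0.
  apply/rowP => i; rewrite !mxE; case: feas => _ bud _ _.
  under eq_bigr => s _ do rewrite !mxE mulr1 mulrBr pibar_mass.
  by rewrite sumrB bud -mulr_suml mustar_sum mul1r subrr.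
by rewrite !mul0mx !subr0.
Qed.

Lemma PhiE k j : Phi P alpha y st k j = Ppibar P y k j - mustar y 0 j
  - (pibar y true k - alpha) * (P st true j - P st false j).
Proof.
have E1 : ((ones R n)^T *m mustar y) k j = mustar y 0 j.
  by rewrite mxE big_ord1 mxE mxE mul1r.
have E2 : ((cvec y - alpha *: ones R n)^T *m (Pa_row P st true - Pa_row P st false)) k j
    = (pibar y true k - alpha) * (P st true j - P st false j).
  by rewrite mxE big_ord1 !mxE mulr1.
by rewrite /Phi mxE [X in X + _]mxE [X in _ + X + _]mxE [X in _ + _ + X]mxE E1 E2.
Qed.

(** The error one arm adds to the linear drift [x Phi]: an action differing from the mean [pibar] is
    offset, through the budget, by arms in [st], which accounts for the last term. *)
Definition arm_dev s (a : bool) j : R :=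
  P s a j - Ppibar P y s j - (a%:R - pibar y true s) * (P st true j - P st false j).

Lemma PpibarE s j :
  Ppibar P y s j = pibar y true s * P s true j + (1 - pibar y true s) * P s false j.
Proof. by rewrite mxE big_bool/= -(pibar_sum s) [X in _ = _ + X * _]addrAC subrr add0r. Qed.

(** In [st] the averaged kernel is affine in the activation probability, so both actions give 0. In
    other states a good action is the one that [pibar] takes surely. *)
Lemma arm_dev_good s a j : 0 < y s a -> arm_dev s a j = 0.
Proof.
rewrite /arm_dev PpibarE; have [->|sst] := eqVneq s st.
  by move=> _; case: a => /=; ring.
move=> ysa; have : pibar y true s = a%:R.
  case: a ysa => ysa; first by rewrite pibar_off ?ysa.
  have := pibar_sum s; rewrite (pibar_off false)// ysa.
  by rewrite -[RHS]add0r => /addIr.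
by move=> ->; case: (a) => /=; ring.
Qed.

Lemma arm_dev_bound s a j : `|arm_dev s a j| <= 2.
Proof.
rewrite /arm_dev PpibarE.
have c0 := pibar_ge0 true s; have c1 := pibar_ge0 false s; have c2 := pibar_sum s.
have p0 z b : 0 <= P z b j by exact: kerP.1.
have p1 z b : P z b j <= 1 by exact: P_le1.
set c := pibar y true s in c0 c2 *.
have d1 : `|P s a j - (c * P s true j + (1 - c) * P s false j)| <= 1.
  have := p0 s true; have := p0 s false; have := p1 s true; have := p1 s false.
  by rewrite ler_norml; case: a => ? ? ? ?; apply/andP; split; nra.
apply: le_trans (ler_normB _ _) _; rewrite -[2]/(1 + 1) lerD// normrM.
apply: mulr_ile1 => //; first by rewrite ler_norml; case: (a) => /=; apply/andP; split; lra.
have := p0 st true; have := p0 st false; have := p1 st true; have := p1 st false.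
by rewrite ler_norml => ? ? ? ?; apply/andP; split; lra.
Qed.

(** * Drift, noise and repair of actions for [N] arms *)

Section FixN.
Variables (N nb : nat).
Hypothesis N_gt0 : (0 < N)%N.
Hypothesis nbE : nb%:R = alpha * N%:R.
Implicit Types (s : Sn n N) (a : An N).

Let N_neq0 : N%:R != 0 :> R. Proof. by rewrite pnatr_eq0 -lt0n. Qed.

Definition bad s a : {set 'I_N} := [set i | ~~ (0 < y (s i) (a i))].
Definition bad_frac s a : R := #|bad s a|%:R / N%:R.

Lemma bad_frac_ge0 s a : 0 <= bad_frac s a.
Proof. by rewrite /bad_frac. Qed.

Definition mean_next s a : 'rV[R]_n := \row_j (N%:R^-1 * \sum_i P (s i) (a i) j).

Lemma XempE s j : Xemp R s 0 j = N%:R^-1 * \sum_i (s i == j)%:R.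
Proof.
rewrite mxE mulrC /zcount -sum1_card natr_sum big_mkcond/=; congr (_ * _).
by apply: eq_bigr => i _; rewrite inE; case: ifP.
Qed.

Lemma Xemp_sum s (f : 'I_n -> R) :
  \sum_j Xemp R s 0 j * f j = N%:R^-1 * \sum_i f (s i).
Proof.
under eq_bigr => j _ do rewrite XempE -mulrA mulr_suml.
rewrite -mulr_sumr exchange_big; congr (_ * _); apply: eq_bigr => i _ /=.
rewrite (bigD1 (s i))//= eqxx mul1r big1 ?addr0// => j.
by rewrite eq_sym => /negbTE->; rewrite mul0r.
Qed.

Lemma nactive_sum a : (nactive a)%:R = \sum_i (a i)%:R :> R.
Proof.
rewrite /nactive -sum1_card natr_sum big_mkcond/=.
by apply: eq_bigr => i _; rewrite inE; case: (a i).
Qed.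

Lemma mean_next_dev s a j : nactive a = nb ->
  (mean_next s a - mustar y - (Xemp R s - mustar y) *m Phi P alpha y st) 0 j =
  N%:R^-1 * \sum_i arm_dev (s i) (a i) j.
Proof.
move=> act; rewrite mulmxBl mustar_Phi subr0.
pose De := P st true j - P st false j.
have XPhi : (Xemp R s *m Phi P alpha y st) 0 j = N%:R^-1 *
    \sum_i (Ppibar P y (s i) j - mustar y 0 j - (pibar y true (s i) - alpha) * De).
  rewrite -(Xemp_sum s (fun k => Ppibar P y k j - mustar y 0 j - (pibar y true k - alpha) * De)).
  by rewrite mxE; apply: eq_bigr => k _; rewrite PhiE.
have -> : (mean_next s a - mustar y - Xemp R s *m Phi P alpha y st) 0 j =
    mean_next s a 0 j - mustar y 0 j - (Xemp R s *m Phi P alpha y st) 0 j.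
  by rewrite mxE [X in X + _]mxE [X in _ + X + _]mxE [X in _ + _ + X]mxE.
rewrite XPhi [mean_next s a 0 j]mxE.
have N1 : N%:R^-1 * \sum_(i < N) mustar y 0 j = mustar y 0 j.
  by rewrite sumr_const card_ord -[X in _ * X]mulr_natr mulrCA mulVf// mulr1.
(* The exact budget makes this term zero; adding it turns the [alpha] in [Phi] into the actual
   actions. *)
have Na : N%:R^-1 * \sum_(i < N) ((a i)%:R - alpha) * De = 0.
  rewrite -mulr_suml sumrB -nactive_sum act nbE sumr_const card_ord.
  by rewrite -[X in _ - X]mulr_natr subrr mul0r mulr0.
rewrite -[X in _ - X - _]N1 -mulrBr -mulrBr -[LHS]subr0 -[X in _ - X]Na.
rewrite -mulrBr; congr (_ * _); rewrite -!sumrB; apply: eq_bigr => i _.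
by rewrite /arm_dev -/De; ring.
Qed.

(** Good arms contribute nothing, and each bad arm at most [2 / N] per coordinate. *)
Lemma mean_next_dev_norm1 s a : nactive a = nb ->
  norm1 (mean_next s a - mustar y - (Xemp R s - mustar y) *m Phi P alpha y st)
    <= 2 * n%:R * bad_frac s a.
Proof.
move=> act.
have -> : 2 * n%:R * bad_frac s a = \sum_(j < n) 2 * bad_frac s a.
  by rewrite sumr_const card_ord -[RHS]mulr_natr; ring.
apply: ler_sum => j _; rewrite mean_next_dev// normrM ger0_norm ?invr_ge0//.
rewrite /bad_frac mulrA mulrC ler_pM2r ?invr_gt0 ?ltr0n//.
apply: le_trans (ler_norm_sum _ _ _) _.
rewrite -sum1_card natr_sum mulr_sumr [leRHS]big_mkcond/=; apply: ler_sum => i _.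
rewrite inE; case: (boolP (0 < _)) => h /=; first by rewrite arm_dev_good// normr0.
by rewrite mulr1 arm_dev_bound.
Qed.

(** Changing the state of one arm moves mass [1 / N] from one state to another. *)
Lemma Xemp_lipschitz (w w' : Sn n N) :
  norm1 (Xemp R w - Xemp R w') <= 2 / N%:R * \sum_i (w i != w' i)%:R.
Proof.
rewrite /norm1.
have -> : \sum_j `|(Xemp R w - Xemp R w') 0 j| =
    N%:R^-1 * \sum_j `|\sum_i ((w i == j)%:R - (w' i == j)%:R)|.
  rewrite mulr_sumr; apply: eq_bigr => j _.
  rewrite [in LHS]mxE [X in _ + X]mxE !XempE -mulrBr -sumrB normrM ger0_norm ?invr_ge0//.
rewrite [2 / _]mulrC -mulrA ler_pM2l ?invr_gt0 ?ltr0n//.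
apply: (@le_trans _ _ (\sum_j \sum_i `|(w i == j)%:R - (w' i == j)%:R|)).
  by apply: ler_sum => j _; exact: ler_norm_sum.
rewrite exchange_big mulr_sumr; apply: ler_sum => i _ /=.
have [->|ww'] := eqVneq (w i) (w' i).
  by rewrite big1 ?mulr0// => j _; rewrite subrr normr0.
rewrite mulr1; apply: le_trans (ler_sum _ (fun j _ => ler_normB _ _)) _.
rewrite big_split/=.
have E x : \sum_j `|(x == j)%:R| = 1 :> R.
  rewrite (bigD1 x)//= eqxx normr1 big1 ?addr0// => j.
  by rewrite eq_sym => /negbTE->; rewrite normr0.
by rewrite !E.
Qed.

Lemma mean_nextE s a (v : 'rV[R]_n) :
  \sum_s' PN P s a s' *: (Xemp R s' - v) = mean_next s a - v.
Proof.
have dp := distributions_PN kerP s a.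
apply/rowP => j; rewrite summxE.
under eq_bigr => w _ do rewrite mxE [X in _ * X]mxE XempE [X in _ + X]mxE.
rewrite PN_Eprod EprodD Eprod_cst// EprodZ Eprod_sum !mxE; congr (_ * _ + _).
apply: eq_bigr => i _; rewrite (Eprod_coord dp i (fun t => (t == j)%:R)).
by rewrite (bigD1 j)//= eqxx mulr1 big1 ?addr0// => k /negbTE->; rewrite mulr0.
Qed.

(** In each coordinate the noise is [1 / N] times a centred sum of [N] independent terms bounded by
    1. *)
Lemma noise_norm1 s a :
  \sum_s' PN P s a s' * norm1 (Xemp R s' - mean_next s a) <= n%:R / Num.sqrt N%:R.
Proof.
have dp := distributions_PN kerP s a.
rewrite PN_Eprod Eprod_sum mulr_natl -[n in leRHS]card_ord -sumr_const.
apply: ler_sum => j _.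
pose g i (t : 'I_n) : R := (t == j)%:R - P (s i) (a i) j.
have sN : 0 < Num.sqrt N%:R :> R by rewrite sqrtr_gt0 ltr0n.
have -> : (Num.sqrt N%:R)^-1 = N%:R^-1 * Num.sqrt N%:R :> R.
  have -> : N%:R^-1 = (Num.sqrt N%:R)^-1 * (Num.sqrt N%:R)^-1 :> R.
    by rewrite -invfM -expr2 sqr_sqrtr.
  by rewrite -mulrA mulVf ?mulr1// gt_eqF.
have := @Eprod_norm_centered R 'I_N 'I_n _ dp g.
rewrite card_ord => h; apply: (@le_trans _ _ (N%:R^-1 * Eprod (fun i => P (s i) (a i)) (fun w => `|\sum_i g i (w i)|))).
  rewrite -EprodZ; apply: Eprod_le => // w.
  rewrite [in leLHS]mxE [X in _ + X]mxE XempE mxE -mulrBr -sumrB normrM ger0_norm ?invr_ge0//.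
rewrite ler_pM2l ?invr_gt0 ?ltr0n//; apply: h => // [i|i t].
  rewrite /g; under eq_bigr => t _ do rewrite mulrBr.
  rewrite sumrB -mulr_suml (kerP.2 (s i) (a i)) mul1r (bigD1 j)//= eqxx mulr1 big1 ?addr0 ?subrr// => k.
  by move/negbTE->; rewrite mulr0.
have := kerP.1 (s i) (a i) j; have := P_le1 (s i) (a i) j.
by rewrite /g ler_norml; case: (_ == _) => /= ? ?; apply/andP; split; lra.
Qed.

Lemma zcount_sum s (f : 'I_n -> R) :
  \sum_j f j * (zcount s j)%:R = \sum_i f (s i).
Proof.
transitivity (N%:R * \sum_j Xemp R s 0 j * f j); last by rewrite Xemp_sum mulVKf.
rewrite mulr_sumr; apply: eq_bigr => j _.
by rewrite mxE; field.
Qed.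

(** The action is repaired in two stages: the bad arms are switched, and then the active set inside
    [st] is resized to restore the budget. The second stage changes no more arms than the first. *)
Lemma OLC_near_action s a : nactive a = nb -> OLC_defined y st nb s ->
  exists a' : An N, OLC_support y st nb s a' /\
    (#|[set i | a i != a' i]| <= 2 * #|bad s a|)%N.
Proof.
move=> act [olc1 olc0].
have card_sum (S : {set 'I_N}) : #|S| = (\sum_i (i \in S))%N.
  by rewrite -sum1_card big_mkcond; apply: eq_bigr => i _; case: (_ \in _).
have y0 z b : (y z b == 0) = ~~ (0 < y z b) by rewrite lt0r y_ge0 andbT negbK.
have stE z : (z == st) = (0 < y z false) && (0 < y z true).
  by apply/eqP/idP => /st_uniq.
have vis z : (0 < y z false) || (0 < y z true).
  have := y_visit z; apply: contraTT; rewrite negb_or -!leNgt => /andP[? ?]; lra.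
pose Sp := [set i | Splus y (s i)]; pose Sm := [set i | Sminus y (s i)].
pose U := [set i | s i == st]; pose A := [set i | a i].
have actA : #|A| = nb by [].
have SpE : \sum_(j | j != st) pibar y true j * (zcount s j)%:R = #|Sp|%:R :> R.
  rewrite card_sum natr_sum big_mkcond/=.
  transitivity (\sum_j (if j != st then pibar y true j else 0) * (zcount s j)%:R).
    by apply: eq_bigr => j _; case: ifP => _; rewrite ?mul0r.
  rewrite zcount_sum; apply: eq_bigr => i _; rewrite inE /Splus y0.
  case: ifPn => si; first rewrite pibar_off//; move: si (vis (s i)); rewrite stE;
  by do 2!case: (0 < _).
have SmE : \sum_(j | j != st) pibar y false j * (zcount s j)%:R = #|Sm|%:R :> R.
  rewrite card_sum natr_sum big_mkcond/=.
  transitivity (\sum_j (if j != st then pibar y false j else 0) * (zcount s j)%:R).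
    by apply: eq_bigr => j _; case: ifP => _; rewrite ?mul0r.
  rewrite zcount_sum; apply: eq_bigr => i _; rewrite inE /Sminus y0.
  case: ifPn => si; first rewrite pibar_off//; move: si (vis (s i)); rewrite stE;
  by do 2!case: (0 < _).
have Sp_le : (#|Sp| <= nb)%N.
  rewrite -(ler_nat R) -SpE; apply: le_trans olc1 _.
  by have := ler0n R #|Sempty y|; lra.
have Sm_le : (#|Sm| + nb <= N)%N.
  rewrite -(ler_nat R) natrD -SmE -lerBrDr; apply: le_trans olc0 _.
  by have := ler0n R #|Sempty y|; lra.
have partN : (#|Sp| + #|Sm| + #|U| = N)%N.
  rewrite !card_sum -!big_split/= -[RHS]card_ord -sum1_card; apply: eq_bigr => i _.
  rewrite !inE /Splus /Sminus !y0 stE; move: (vis (s i)).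
  by do 2!case: (0 < _).
pose T := U :&: A.
(* Counting the active arms by class: the imbalance to be corrected in [st] is the number of bad
   passive arms minus the number of bad active ones. *)
have cardA : (#|A| + #|Sp :\: A| = #|T| + #|Sp| + #|Sm :&: A|)%N.
  rewrite !card_sum -!big_split/=; apply: eq_bigr => i _.
  rewrite !inE /Splus /Sminus !y0 stE; move: (vis (s i)).
  by do 2!case: (0 < _); case: (a i).
have badE : #|bad s a| = (#|Sp :\: A| + #|Sm :&: A|)%N.
  rewrite !card_sum -!big_split/=; apply: eq_bigr => i _.
  rewrite !inE /Splus /Sminus !y0; move: (vis (s i)).
  by case: (a i); do 2!case: (0 < _).
(* The arms in [st] have room for the remaining budget: at least [#|Sm|] arms stay passive outside
   [st], and [#|Sm| + nb] is at most [N]. *)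
have [|V [VU cV TV]] := @resize_subset _ T U (nb - #|Sp|) (subsetIl _ _); first by lia.
have Vst i : i \in V -> (0 < y (s i) false) && (0 < y (s i) true).
  by move/(subsetP VU); rewrite inE -stE.
pose a' : An N := [ffun i => (i \in Sp) || (i \in V)].
exists a'; split.
  split.
  - have -> : nactive a' = (#|Sp| + #|V|)%N; last by rewrite cV; lia.
    rewrite /nactive !card_sum -big_split/=; apply: eq_bigr => i _.
    rewrite !inE ffunE inE /Splus y0; have := Vst i; case: (i \in V) => [/(_ isT)|_].
      by move/andP => [-> ->].
    by rewrite orbF addn0.
  - by move=> i si; rewrite ffunE inE si.
  - move=> i si; rewrite ffunE inE; apply/negP; move: si; rewrite /Splus /Sminus y0.
    by move=> /andP[/negbTE yt _]; rewrite yt => /Vst; rewrite yt andbF.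
  - by move=> j; rewrite /Sempty !y0; move: (vis j); do 2!case: (0 < _).
have : (#|[set i | a i != a' i]| <= #|bad s a| + #|(T :\: V) :|: (V :\: T)|)%N.
  rewrite !card_sum -!big_split/=; apply: leq_sum => i _.
  rewrite !inE !ffunE !inE /Splus y0 stE; have := vis (s i); have := Vst i.
  case: (i \in V) => [/(_ isT)/andP[-> ->]|_]; first by case: (a i); rewrite /= ?addn1.
  by case: (a i); case: (0 < y (s i) false); case: (0 < y (s i) true).
move/leq_trans; apply; rewrite TV badE; lia.
Qed.

Lemma dot_le_norm1 (u x : 'rV[R]_n) : \sum_j u 0 j ^+ 2 = 1 ->
  `|(x *m u^T) 0 0| <= norm1 x.
Proof.
move=> u1; rewrite mxE; apply: le_trans (ler_norm_sum _ _ _) _.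
apply: ler_sum => j _; rewrite normrM mxE ler_piMr//.
rewrite -(@expr_le1 _ 2)// real_normK ?num_real// -u1.
by apply: (@ler_sum_term _ _ (fun j => u 0 j ^+ 2)) => k; exact: sqr_ge0.
Qed.

(** The next states under [a] and under the repaired action are coupled. They use different actions
    on at most [2 * #|bad s a|] arms, and each differing arm moves the test function by at most
    [2 / N]. *)
Lemma near_noise s a (u : 'rV[R]_n) k : \sum_j u 0 j ^+ 2 = 1 ->
  nactive a = nb -> OLC_defined y st nb s ->
  let F := fun s' : Sn n N => `|((Xemp R s' - mustar y
             - (Xemp R s - mustar y) *m Phi P alpha y st) *m u^T) 0 0| in
  (forall a', OLC_support y st nb s a' -> k <= \sum_s' PN P s a' s' * F s') ->
  k - 4 * bad_frac s a <= \sum_s' PN P s a s' * F s'.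
Proof.
move=> u1 act olc F noise; have [a' [sup diff]] := OLC_near_action act olc.
have := noise _ sup; rewrite !PN_Eprod => ka'.
pose J := [set i | a i != a' i].
have cpl : Eprod (fun i => P (s i) (a' i)) F - Eprod (fun i => P (s i) (a i)) F
    <= 2 / N%:R * #|J|%:R.
  apply: (Eprod_coupling (distributions_PN kerP s a') (distributions_PN kerP s a)).
  - by move=> i; rewrite inE negbK => /eqP->.
  - by rewrite divr_ge0.
  move=> w w'; apply: (le_trans _ (Xemp_lipschitz w w')).
  apply: (le_trans _ (dot_le_norm1 (Xemp R w - Xemp R w') u1)).
  have -> : ((Xemp R w - Xemp R w') *m u^T) 0 0 =
     ((Xemp R w - mustar y - (Xemp R s - mustar y) *m Phi P alpha y st) *m u^T) 0 0 -
     ((Xemp R w' - mustar y - (Xemp R s - mustar y) *m Phi P alpha y st) *m u^T) 0 0.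
    rewrite !mxE -sumrB; apply: eq_bigr => j _.
    by rewrite -mulrBl; congr (_ * _); rewrite !mxE; ring.
  exact: lerB_dist.
have : 2 / N%:R * #|J|%:R <= 4 * bad_frac s a.
  have d2 : #|J|%:R <= 2 * #|bad s a|%:R :> R by rewrite -natrM ler_nat.
  have -> : 4 * bad_frac s a = 2 / N%:R * (2 * #|bad s a|%:R) by rewrite /bad_frac; ring.
  by rewrite ler_wpM2l// divr_ge0.
by lra.
Qed.

(** By Jensen's inequality the noise cannot lower the mean of a seminorm, so only the bad arms cost
    anything. *)
Lemma seminorm_drift s a (H : 'rV[R]_n -> R) C : seminorm H -> 0 <= C ->
  (forall x, H x <= C * norm1 x) -> nactive a = nb ->
  H ((Xemp R s - mustar y) *m Phi P alpha y st) - C * (2 * n%:R * bad_frac s a)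
    <= \sum_s' PN P s a s' * H (Xemp R s' - mustar y).
Proof.
move=> sH C_ge0 HC act; set z := _ *m _.
have PN_ge0 s' : 0 <= PN P s a s' by apply: prodr_ge0 => i _; exact: kerP.1.
have jensen : H (mean_next s a - mustar y) <= \sum_s' PN P s a s' * H (Xemp R s' - mustar y).
  rewrite -mean_nextE; apply: le_trans (seminorm_sum sH _ _) _.
  by apply: ler_sum => s' _; rewrite ger0_norm.
have := seminorm_lb sH z (mean_next s a - mustar y).
rewrite -[z - _]opprB (seminormN sH) => h1.
have h2 := HC (mean_next s a - mustar y - z).
have h3 := ler_wpM2l C_ge0 (mean_next_dev_norm1 s act).
rewrite -/z in h3; lra.
Qed.

(** No convexity is assumed of [G], so the noise is charged through the Lipschitz constant and costs
    a term of order [1 / sqrt N]. *)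
Lemma lipschitz_drift s a (G : 'rV[R]_n -> R) L : 0 <= L ->
  (forall x z, `|G x - G z| <= L * norm1 (x - z)) -> nactive a = nb ->
  G ((Xemp R s - mustar y) *m Phi P alpha y st)
     - L * (n%:R / Num.sqrt N%:R + 2 * n%:R * bad_frac s a)
    <= \sum_s' PN P s a s' * G (Xemp R s' - mustar y).
Proof.
move=> L_ge0 lipG act; set z := _ *m _.
have dp := distributions_PN kerP s a.
pose b := mean_next s a - mustar y - z.
have ptw s' : (G z - L * norm1 b) + - L * norm1 (Xemp R s' - mean_next s a) <= G (Xemp R s' - mustar y).
  have := lipG z (Xemp R s' - mustar y); have := ler_norm (G z - G (Xemp R s' - mustar y)).
  have tri : norm1 (z - (Xemp R s' - mustar y)) <= norm1 b + norm1 (Xemp R s' - mean_next s a).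
    have -> : z - (Xemp R s' - mustar y) = - (b + (Xemp R s' - mean_next s a)).
      by apply/rowP => j; rewrite !mxE; ring.
    by rewrite (seminormN (seminorm_norm1 R n)); exact: (seminorm_norm1 R n).1.
  have := ler_wpM2l L_ge0 tri; lra.
have := Eprod_le dp ptw; rewrite EprodD Eprod_cst// EprodZ -!PN_Eprod.
have h1 := ler_wpM2l L_ge0 (noise_norm1 s a).
have h2 := ler_wpM2l L_ge0 (mean_next_dev_norm1 s act).
rewrite -/z -/b in h2; lra.
Qed.
End FixN.
End OneStep.

(* Weighing the expansion bound by [lam + 1] and the noise bound by [lam - 1]
   cancels [h], so the growth is at least of the order of the noise. *)
Lemma unstable_growth (R : realFieldType) (lam h k A D q : R) :
  1 < lam -> 0 <= A -> 0 <= D -> lam * h - A <= q -> k - D - lam * h <= q ->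
  k * ((lam - 1) / (2 * lam)) - (A + D) <= q - h.
Proof.
move=> lam1 A0 D0 h1 h2.
have lam0 : 0 < 2 * lam by lra.
rewrite -(ler_pM2l lam0).
have -> : 2 * lam * (k * ((lam - 1) / (2 * lam)) - (A + D)) = k * (lam - 1) - 2 * lam * (A + D).
  by field; lra.
have lam2 : 0 <= lam - 1 by lra.
have lam3 : 0 <= lam + 1 by lra.
have := ler_wpM2l lam3 h1; have := ler_wpM2l lam2 h2.
have := mulr_ge0 lam2 A0; have := mulr_ge0 lam3 D0; lra.
Qed.

Lemma inv_sqrt_small (R : realType) (e : R) : 0 < e ->
  exists N0 : nat, forall N, (N0 <= N)%N -> (0 < N)%N -> (Num.sqrt N%:R)^-1 <= e.
Proof.
move=> e0; exists (Num.Def.archi_bound (e^-1 ^+ 2)) => N leN N0.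
have e20 : 0 <= e^-1 ^+ 2 by rewrite sqr_ge0.
have sN : 0 < Num.sqrt N%:R :> R by rewrite sqrtr_gt0 ltr0n.
rewrite -[leRHS]invrK lef_pV2 ?posrE ?invr_gt0//.
rewrite -(@ler_pXn2r _ 2) ?nnegrE ?invr_ge0 ?(ltW e0) ?(ltW sN)// sqr_sqrtr ?ler0n//.
by apply: le_trans (ltW (archi_boundP e20)) _; rewrite ler_nat.
Qed.

(** * The combined Lyapunov function and the potential of the [N]-armed problem *)

Section Potential.
Variables (R : realType) (n : nat) (P : 'I_n -> bool -> 'I_n -> R).
Variables (r : 'I_n -> bool -> R) (alpha : R) (y : 'I_n -> bool -> R) (st : 'I_n).
Hypothesis kerP : stochastic_kernel P.
Hypothesis unst : regular_unstable P r alpha y st.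

Let feas : LPfeasible P alpha y.
Proof. by case: unst => _ _ [[[]]]. Qed.
Let y_visit s : 0 < y s true + y s false.
Proof. by case: unst => _ _ [_]. Qed.
Let st_uniq s : (0 < y s false) && (0 < y s true) <-> s = st.
Proof. by case: unst. Qed.

Lemma lyapunov_drift : exists (V : 'rV[R]_n -> R) (c C : R) (N0 : nat),
  [/\ 0 < c, 0 < C & forall N nb, (N0 <= N)%N -> (0 < N)%N -> nb%:R = alpha * N%:R ->
  forall (s : Sn n N) (a : An N), nactive a = nb ->
  c / Num.sqrt N%:R + V (Xemp R s - mustar y) <=
  \sum_s' PN P s a s' * V (Xemp R s' - mustar y) + C * bad_frac y s a].
Proof.
case: unst => _ _ _ [unstab hyper] [eta [K [eta0 [K0 [N1 noise]]]]].
have n_gt0 : (0 < n)%N by exact: leq_ltn_trans (leq0n _) (ltn_ord st).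
have [H [u [lam [sH lam1 HPhi [u1 mu_u Hu]]]]] := unstable_seminorm (mustar_Phi st feas y_visit) unstab.
have [G [L [d [L0 d0 lipG GPhi]]]] := hyperbolic_lyapunov n_gt0 hyper.
have [CH CH0 HC] := seminorm_bound sH.
pose c1 := K * ((lam - 1) / (2 * lam)).
have c10 : 0 < c1 by rewrite !mulr_gt0 ?invr_gt0//; lra.
have n0 : 0 <= n%:R :> R by [].
have Ln0 : 0 <= L * n%:R by rewrite mulr_ge0.
(* With this weight the noise loss [k * L * n / sqrt N] of [G] uses up at most half of the growth
   [c1 / sqrt N] of [H]. *)
pose k := c1 / (2 * (L * n%:R + 1)).
have k0 : 0 < k by rewrite divr_gt0// mulr_gt0//; lra.
have kLn : k * (L * n%:R) <= c1 / 2.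
  have kE : k * (L * n%:R + 1) = c1 / 2 by rewrite /k; field; lra.
  by rewrite -kE ler_pM2l//; lra.
pose V x := H x + k * G x.
pose C := CH * (2 * n%:R) + 4 + k * (L * (2 * n%:R)).
have C0 : 0 < C.
  have := mulr_ge0 CH0 (mulr_ge0 (ler0n R 2) n0).
  by have := mulr_ge0 (ltW k0) (mulr_ge0 L0 (mulr_ge0 (ler0n R 2) n0)); rewrite /C; lra.
(* Once [1 / sqrt N] is below this threshold, the gain [k * d * eta] of [G] far from the fixed point
   exceeds [c1 / sqrt N]. *)
have far0 : 0 < k * (d * eta) / c1 by apply: divr_gt0 => //; do 2!apply: mulr_gt0 => //.
have [N2 N2P] := inv_sqrt_small far0.
exists V, (c1 / 2), C, (maxn N1 N2); split=> //; first by rewrite divr_gt0.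
move=> N nb; rewrite geq_max => /andP[N1N N2N] N0 nbE s a act.
set e := (Num.sqrt N%:R)^-1; have e0 : 0 <= e by rewrite invr_ge0 sqrtr_ge0.
have e_small : e <= k * (d * eta) / c1 by exact: N2P.
set D := bad_frac y s a; have D0 : 0 <= D by exact: bad_frac_ge0.
set x := Xemp R s - mustar y.
set QH := \sum_s' PN P s a s' * H (Xemp R s' - mustar y).
set QG := \sum_s' PN P s a s' * G (Xemp R s' - mustar y).
have -> : \sum_s' PN P s a s' * V (Xemp R s' - mustar y) = QH + k * QG.
  by rewrite /QH /QG mulr_sumr -big_split; apply: eq_bigr => s' _; rewrite /V/=; ring.
have dH : lam * H x - CH * (2 * n%:R * D) <= QH.
  by rewrite -HPhi; exact: (seminorm_drift kerP feas y_visit st_uniq N0 nbE).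
have dG : G x + d * norm1 x - L * (n%:R * e + 2 * n%:R * D) <= QG.
  have := lipschitz_drift kerP feas y_visit st_uniq N0 nbE s L0 lipG act.
  by have := GPhi x; rewrite -/x -/QG -/D -/e; lra.
have H0 : 0 <= H x by exact: seminorm_ge0.
have A0 : 0 <= CH * (2 * n%:R * D) by rewrite !mulr_ge0.
have kdG := ler_wpM2l (ltW k0) dG.
have kLne := ler_wpM2r e0 kLn.
have x0 : 0 <= norm1 x by exact: (seminorm_ge0 (seminorm_norm1 R n)).
have kdx := mulr_ge0 (ltW k0) (mulr_ge0 (ltW d0) x0).
rewrite -/e /V /C.
have [near|far] := leP (norm1 x) eta.
  have [olc nz] := noise N N1N nb nbE s near.
  have nn : K * e - 4 * D <= \sum_s' PN P s a s' *
       `|((Xemp R s' - mustar y - x *m Phi P alpha y st) *m u^T) 0 0|.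
    have := near_noise kerP feas y_visit st_uniq N0 (k := K * e) u1 act olc.
    by apply=> a' /nz; exact.
  (* The noise in direction [u] is at most [H] of the new point minus [x Phi], hence at most the sum
     of the two values of [H]; the second is [lam * H x]. *)
  have dH2 : K * e - 4 * D - lam * H x <= QH.
    apply: le_trans (lerB nn (lexx _)) _; rewrite -HPhi.
    rewrite lerBlDr -[X in QH + X](Eprod_cst (distributions_PN kerP s a)).
    rewrite /QH !PN_Eprod -EprodD; apply: (Eprod_le (distributions_PN kerP s a)) => s'.
    apply: le_trans (Hu _) _; apply: le_trans (sH.1 _ _) _.
    by rewrite (seminormN sH).
  have D4 : 0 <= 4 * D by rewrite mulr_ge0.
  have := unstable_growth lam1 A0 D4 dH dH2.
  have -> : K * e * ((lam - 1) / (2 * lam)) = c1 * e by rewrite /c1; ring.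
  lra.
(* Far from the fixed point [H] need only not decrease on average, up to bad arms; the gain comes
   from [G]. *)
have lH : H x <= lam * H x by rewrite ler_peMl// ltW.
have dfar : k * (d * eta) <= k * (d * norm1 x) by rewrite ler_pM2l// ler_pM2l// ltW.
have ce : e * c1 <= k * (d * eta) by rewrite -ler_pdivlMr.
lra.
Qed.

(** The potential is the averaged relative value function plus a multiple of [V]. The first part
    yields the LP value minus the reduced costs of the bad arms, and these pay for the bad arms in
    the drift of [V]. *)
Lemma potential : exists c : R, 0 < c /\ exists N0 : nat,
  forall N nb, (N0 <= N)%N -> nb%:R = alpha * N%:R ->
  exists G : Sn n N -> R, forall (s : Sn n N) (a : An N), nactive a = nb ->
    c / Num.sqrt N%:R + reward r s a <= LPobj r y - G s + \sum_s' PN P s a s' * G s'.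
Proof.
case: (unst) => _ _ [[opt uniq_opt] _] _ _.
have y_st b : 0 < y st b.
  by have /andP[y0 y1] := (st_uniq st).2 erefl; case: b.
have [h [lm [g [rho [rhoE rho0 rho1]]]]] :=
  lp_strict_complementarity kerP opt uniq_opt y_visit y_st.
(* [rm] is a positive lower bound for the reduced cost of bad pairs; good pairs get the default 1,
   because their [rho] is 0. *)
have [|rm rm0 rm_le] := @finite_pos_lower_bound R ('I_n * bool)%type
    (fun x => if 0 < y x.1 x.2 then 1 else rho x.1 x.2).
  by move=> x; case: ifPn => [//|]; exact: rho1.
have [V [c [C [N0 [c0 C0 drift]]]]] := lyapunov_drift.
(* With this weight the loss [k * C] per unit of bad fraction equals the guaranteed reduced cost
   [rm]. *)
pose k := rm / C; have k0 : 0 < k by rewrite divr_gt0.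
exists (k * c); split; first by rewrite mulr_gt0.
exists (maxn 1 N0) => N nb; rewrite geq_max => /andP[N_gt0 N0N] nbE.
have N_neq0 : N%:R != 0 :> R by rewrite pnatr_eq0 -lt0n.
(* Strong duality: the dual identity is integrated against [y], where complementary slackness
   removes [rho] and the balance equations cancel [h]. *)
have objE : LPobj r y = alpha * lm + g.
  have [y_ge0 bud bal tot] := feas.
  transitivity (\sum_s \sum_a (\sum_j P s a j * h j - h s + a%:R * lm + g) * y s a).
    apply: eq_bigr => s _; apply: eq_bigr => a _; rewrite -rhoE.
    have [/rho0->|ya] := ltP 0 (y s a); first by rewrite addr0.
    have -> : y s a = 0 by apply/eqP; rewrite eq_le ya y_ge0.
    by rewrite !mulr0.
  have E1 : \sum_s \sum_a (\sum_j P s a j * h j) * y s a = \sum_s \sum_a h s * y s a.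
    transitivity (\sum_j (\sum_s \sum_a y s a * P s a j) * h j).
      under [RHS]eq_bigr => j _ do rewrite mulr_suml.
      rewrite [RHS]exchange_big; apply: eq_bigr => s _.
      under [RHS]eq_bigr => j _ do rewrite mulr_suml.
      rewrite [RHS]exchange_big; apply: eq_bigr => a _.
      by rewrite mulr_suml; apply: eq_bigr => j _ /=; ring.
    by apply: eq_bigr => j _; rewrite bal mulrC mulr_sumr.
  have E2 : \sum_s \sum_(a : bool) (a%:R * lm) * y s a = alpha * lm.
    rewrite -bud mulr_suml; apply: eq_bigr => s _.
    by rewrite big_bool/= !mul0r addr0; ring.
  have E3 : \sum_s \sum_a g * y s a = g.
    rewrite -[RHS]mulr1 -tot mulr_sumr; apply: eq_bigr => s _.
    by rewrite mulr_sumr.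
  transitivity (\sum_s \sum_a (\sum_j P s a j * h j) * y s a - \sum_s \sum_a h s * y s a
      + \sum_s \sum_(a : bool) (a%:R * lm) * y s a + \sum_s \sum_a g * y s a).
    rewrite -sumrB -!big_split; apply: eq_bigr => s _ /=.
    rewrite -sumrB -!big_split; apply: eq_bigr => a _ /=; ring.
  by rewrite E1 E2 E3 subrr add0r.
pose hX (s : Sn n N) := \sum_j Xemp R s 0 j * h j.
exists (fun s => hX s + k * V (Xemp R s - mustar y)) => s a act.
have dp := distributions_PN kerP s a.
have -> : \sum_s' PN P s a s' * (hX s' + k * V (Xemp R s' - mustar y)) =
    \sum_s' PN P s a s' * hX s' + k * \sum_s' PN P s a s' * V (Xemp R s' - mustar y).
  by rewrite !PN_Eprod EprodD EprodZ.
have EhX : \sum_s' PN P s a s' * hX s' = N%:R^-1 * \sum_i \sum_j P (s i) (a i) j * h j.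
  rewrite (eq_bigr (fun s' => PN P s a s' * (N%:R^-1 * \sum_i h (s' i)))).
    rewrite PN_Eprod EprodZ Eprod_sum; congr (_ * _); apply: eq_bigr => i _.
    exact: (Eprod_coord dp).
  by move=> s' _; rewrite /hX Xemp_sum.
(* The dual identity summed over the arms is exact: the budget turns the price terms into
   [alpha * lm], and the rest is the one-step change of [hX] minus the reduced costs. *)
have rewardE : reward r s a = LPobj r y + \sum_s' PN P s a s' * hX s' - hX s
    - N%:R^-1 * \sum_i rho (s i) (a i).
  rewrite EhX /hX Xemp_sum objE /reward.
  have -> : alpha * lm + g = N%:R^-1 * \sum_i ((a i)%:R * lm + g).
    rewrite big_split/= -mulr_suml -nactive_sum act nbE sumr_const card_ord -[g *+ N]mulr_natr.
    by field.
  rewrite -!mulrDr -!mulrBr; congr (_ * _).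
  rewrite -!big_split/= -!sumrB; apply: eq_bigr => i _.
  by have := rhoE (s i) (a i); lra.
have rhoD : rm * bad_frac y s a <= N%:R^-1 * \sum_i rho (s i) (a i).
  rewrite /bad_frac mulrA mulrC ler_pM2l ?invr_gt0 ?ltr0n//.
  rewrite -sum1_card natr_sum mulr_sumr big_mkcond/=; apply: ler_sum => i _.
  rewrite inE; have := rm_le (s i, a i); case: (boolP (0 < y (s i) (a i))) => /= [ya _|_ le].
    by rewrite rho0.
  by rewrite mulr1.
have kd := ler_wpM2l (ltW k0) (drift N nb N0N N_gt0 nbE s a act).
have kC : k * (C * bad_frac y s a) = rm * bad_frac y s a by rewrite mulrA divfK// gt_eqF.
rewrite !mulrDr kC in kd; rewrite rewardE -mulrA; lra.
Qed.
End Potential.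

Local Open Scope classical_set_scope.

Theorem theorem2 (R : realType) (n : nat)
  (P : 'I_n -> bool -> 'I_n -> R) (r : 'I_n -> bool -> R) (alpha : R)
  (ystar : 'I_n -> bool -> R) (st : 'I_n) :
  stochastic_kernel P -> 0 < alpha < 1 ->
  regular_unstable P r alpha ystar st ->
  exists c : R, 0 < c /\
  exists N0 : nat, forall N : nat, (N0 <= N)%N ->
  forall nb : nat, nb%:R = alpha * N%:R ->
  forall pi : policy R n N, valid_policy nb pi ->
  forall (S0 : Sn n N) (l : R),
    avg_reward P r pi S0 @ \oo --> l ->
    c / Num.sqrt N%:R <= LPobj r ystar - l.
Proof.
move=> kerP _ unst; have [c [c0 [N0 pot]]] := potential kerP unst.
exists c; split=> //; exists N0 => N N0N nb nbE pi vpi S0 l cvl.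
have [G drift] := pot N nb N0N nbE.
exact: (avg_reward_le kerP vpi drift cvl).
Qed.
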